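(* Let $\varphi$ be a hyperbolic conformal automorphism of the closed unit disk $\mathbb{D}$ which fixes $1$ and $-1$. Let $\pi$ be an irreducible representation of $C(\mathbb{D})\rtimes_\varphi\mathbb{Z}$. Then $\pi$ is unitarily equivalent to one of the representations in $$\operatorname{IrrRep}=\{\pi_x,\ \pi_{\theta,\varepsilon} : x\in\mathbb{D}\setminus\{-1,1\},\ \varepsilon\in\{-1,1\},\ \theta\in[0,1)\}.$$
   Context: $\mathbb{D}=\{z\in\mathbb{C}:|z|\le 1\}$, $\mathbb{T}=\{|z|=1\}$. Conformal automorphisms of $\mathbb{D}$ are the maps $z\mapsto e^{2i\pi\theta}\frac{z-z_0}{1-\overline{z_0}z}$ with $|z_0|<1$; such a map is hyperbolic if it has exactly two distinct fixed points in $\mathbb{D}$ (they then lie on $\mathbb{T}$). For a homeomorphism $\varphi$ of $\mathbb{D}$, $C(\mathbb{D})\rtimes_\varphi\mathbb{Z}$ is the universal C*-algebra generated by $C(\mathbb{D})$ and a unitary $U_\varphi$ with $U_\varphi^*fU_\varphi=f\circ\varphi$ for all $f\in C(\mathbb{D})$; $A_\varphi$ denotes the function $z\mapsto z$ in $C(\mathbb{D})$, a normal generator of $C(\mathbb{D})$ with spectrum $\mathbb{D}$. Thus the crossed product is generated by $A_\varphi$ and $U_\varphi$. For $\varepsilon\in\{-1,1\}$ and $\theta\in[0,1)$, $\pi_{\theta,\varepsilon}$ is the one-dimensional representation with $\pi_{\theta,\varepsilon}(A_\varphi)=\varepsilon$ and $\pi_{\theta,\varepsilon}(U_\varphi)=e^{2i\pi\theta}$.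 For $x\in\mathbb{D}\setminus\{-1,1\}$, $\pi_x$ is the representation on $l^2(\mathbb{Z})$ with $\pi_x(A_\varphi)e_n=\varphi^n(x)e_n$ and $\pi_x(U_\varphi)e_n=e_{n+1}$ for all $n\in\mathbb{Z}$, where $(e_n)_{n\in\mathbb{Z}}$ is the canonical basis. *)

(* Defs.v *)
From HB Require Import structures.
From mathcomp Require Import all_boot all_order all_algebra.
From mathcomp Require Import all_classical all_reals all_analysis.
From mathcomp Require Import complex ring lra.
Set Implicit Arguments. Unset Strict Implicit. Unset Printing Implicit Defensive.
Import Order.TTheory GRing.Theory Num.Theory.
Import numFieldNormedType.Exports.
Local Open Scope classical_set_scope.
Local Open Scope ring_scope.

(* R[i] carries no topology in the libraries; the instances below transport the
   norm topology of the regular module R[i]^o. *)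
Section ComplexTopology.
Variable R : realType.

HB.instance Definition _ := GRing.ComAlgebra.copy R[i] R[i]^o.
HB.instance Definition _ := NormedModule.copy R[i] R[i]^o.

Lemma complex_norm_le (z : R[i]) :
  `|z| <= (`|complex.Re z| + `|complex.Im z|)%:C%C.
Proof.
rewrite normc_def lecR -[leRHS]ger0_norm ?addr_ge0// -sqrtr_sqr ler_wsqrtr//.
rewrite sqrrD !real_normK ?num_real//.
have := mulr_ge0 (normr_ge0 (complex.Re z)) (normr_ge0 (complex.Im z)).
by move: (_ * _) => t t0; lra.
Qed.

Lemma complex_norm_ge_Im (z : R[i]) : `|complex.Im z|%:C%C <= `|z|.
Proof.
rewrite normc_def lecR -[leLHS]sqrtr_sqr.
by rewrite ler_wsqrtr// lerDr sqr_ge0.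
Qed.

Lemma complex_complete (F : set_system R[i]) :
  ProperFilter F -> cauchy F -> cvg F.
Proof.
move=> FF /cauchy_ballP Fc.
have key (f : R[i] -> R) : {morph f : x y / x - y} ->
    (forall z, `|f z|%:C%C <= `|z|) -> cvg (f @ F).
  move=> fB fle; apply/cauchy_cvgP/cauchy_ballP => e e0; near_simpl.
  have := Fc e%:C%C; rewrite ltcR => /(_ e0).
  apply: filterS => -[x y] /=; rewrite -!ball_normE /= => xy.
  rewrite -ltcR (le_lt_trans _ xy)// (le_trans _ (fle _))//.
  by rewrite fB.
have cRe : cvg (@complex.Re R @ F).
  by apply: key; [move=> [? ?] [? ?]|exact: normc_ge_Re].
have cIm : cvg (@complex.Im R @ F).
  by apply: key; [move=> [? ?] [? ?]|exact: complex_norm_ge_Im].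
apply/cvg_ex; exists (lim (@complex.Re R @ F) +i* lim (@complex.Im R @ F))%C.
apply/cvgrPdist_lt => e; rewrite ltcE /= => /andP[/eqP ei e0].
have h0 : 0 < complex.Re e / 2 by rewrite divr_gt0.
move/cvgrPdist_lt : cRe => /(_ _ h0) cRe.
move/cvgrPdist_lt : cIm => /(_ _ h0) cIm.
near=> z.
rewrite (le_lt_trans (complex_norm_le _))//.
have -> : e = (complex.Re e)%:C%C by case: (e) ei => a b /= ->.
rewrite ltcR [ltRHS]splitr ltrD//.
  have : `|lim (@complex.Re R @ F) - complex.Re z| < complex.Re e / 2.
    by near: z; exact: cRe.
  by case: (z).
have : `|lim (@complex.Im R @ F) - complex.Im z| < complex.Re e / 2.
  by near: z; exact: cIm.
by case: (z).
Unshelve. all: by end_near. Qed.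

HB.instance Definition _ := Uniform_isComplete.Build R[i] complex_complete.

Lemma complex_series_cvg (u : nat -> R[i]) (v : nat -> R) :
  (forall k, `|u k| <= (v k)%:C%C) -> cvgn (series v) -> cvgn (series u).
Proof.
move=> uv /cauchy_cvgP/cauchy_seriesP cv.
apply/cauchy_cvgP/cauchy_seriesP => e; rewrite ltcE /= => /andP[/eqP ei e0].
have := cv _ e0; apply: filterS => n /= Hn.
have -> : e = (complex.Re e)%:C%C by case: (e) ei => a b /= ->.
rewrite (le_lt_trans (ler_norm_sum _ _ _))//.
rewrite (@le_lt_trans _ _ (\sum_(n.1 <= k < n.2) v k)%:C%C)//.
  by rewrite rmorph_sum; apply: ler_sum.
by rewrite ltcR (le_lt_trans _ Hn)// ler_norm.
Qed.

Lemma complex_cvg_real (u : nat -> R) (l : R) :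
  u @ \oo --> l -> (fun k => (u k)%:C%C) @ \oo --> l%:C%C.
Proof.
move=> /cvgrPdist_lt ul; apply/cvgrPdist_lt => e.
rewrite ltcE /= => /andP[/eqP ei e0].
have := ul _ e0; apply: filterS => n Hn.
have -> : e = (complex.Re e)%:C%C by case: (e) ei => a b /= ->.
by rewrite -rmorphB /= normc_def/= expr0n/= addr0 sqrtr_sqr ltcR.
Qed.

Lemma complex_cvg_conj (u : nat -> R[i]) (l : R[i]) :
  u @ \oo --> l -> (fun k => (u k)^* ) @ \oo --> l^*.
Proof.
move=> /cvgrPdist_lt ul; apply/cvgrPdist_lt => e e0.
have := ul _ e0; apply: filterS => n Hn.
by rewrite -rmorphB norm_conjC.
Qed.

End ComplexTopology.

HB.mixin Record isPreHilbert (R : realType) H & GRing.Lmodule R[i] H := {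
  inner : H -> H -> R[i];
  innerDl : forall x y z, inner (x + y) z = inner x z + inner y z;
  innerZl : forall a x z, inner (a *: x) z = a * inner x z;
  inner_conj : forall x y, inner y x = (inner x y)^*;
  inner_ge0 : forall x, 0 <= inner x x;
  inner_eq0 : forall x, inner x x = 0 -> x = 0
}.

#[short(type="preHilbertType")]
HB.structure Definition PreHilbert (R : realType) :=
  {H of GRing.Lmodule R[i] H & isPreHilbert R H}.

HB.mixin Record isHilbert (R : realType) H
    & CompleteNormedModule R[i] H & PreHilbert R H := {
  sqr_norm_inner : forall x : H, `|x| ^+ 2 = inner x x
}.

(* The inner product is linear in its first argument. Norms of modules over R[i]
   take values in the nonnegative reals of R[i]. *)
#[short(type="hilbertType")]
HB.structure Definition Hilbert (R : realType) :=
  {H of CompleteNormedModule R[i] H & PreHilbert R H & isHilbert R H}.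

Section PreHilbertTheory.
Variables (R : realType) (H : preHilbertType R).
Implicit Types (x y z : H).

Definition inner_norm x : R[i] := sqrtC (inner x x).

Lemma innerDr x y z : inner x (y + z) = inner x y + inner x z.
Proof. by rewrite inner_conj innerDl rmorphD /= -!inner_conj. Qed.

Lemma innerZr a x z : inner x (a *: z) = a^* * inner x z.
Proof. by rewrite inner_conj innerZl rmorphM /= -inner_conj. Qed.

Lemma inner_norm_sqr x : inner_norm x ^+ 2 = inner x x.
Proof. by rewrite sqrtCK. Qed.

Lemma inner_norm_ge0 x : 0 <= inner_norm x.
Proof. by rewrite sqrtC_ge0 inner_ge0. Qed.

Lemma inner_normZ a x : inner_norm (a *: x) = `|a| * inner_norm x.
Proof.
rewrite /inner_norm innerZl innerZr mulrA -normCK.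
by rewrite sqrtCM ?nnegrE ?exprn_ge0 ?inner_ge0// sqrCK.
Qed.

Lemma inner_norm0_eq0 x : inner_norm x = 0 -> x = 0.
Proof. by move/eqP; rewrite sqrtC_eq0 => /eqP/inner_eq0. Qed.

Lemma inner_le x y : `|inner x y| <= inner_norm x * inner_norm y.
Proof.
have [->|y0] := eqVneq y 0.
  rewrite -(scale0r (0 : H)) innerZr rmorph0 mul0r normr0.
  by rewrite mulr_ge0 ?inner_norm_ge0.
have yy : inner y y != 0 by apply: contra y0 => /eqP/inner_eq0 ->.
rewrite -(@ler_pXn2r _ 2)// ?nnegrE ?mulr_ge0 ?inner_norm_ge0//.
rewrite exprMn !inner_norm_sqr.
have yy0 : 0 < inner y y by rewrite lt_def yy inner_ge0.
have := inner_ge0 (x + (- (inner x y / inner y y)) *: y).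
rewrite !(innerDl, innerDr, innerZl, innerZr) (inner_conj x y).
rewrite !rmorphN !rmorphM fmorphV /= -(inner_conj y y).
set e := (X in 0 <= X).
have -> : e = inner x x - `|inner x y| ^+ 2 / inner y y.
  rewrite /e normCK.
  move: yy; move: (inner y y) (inner x x) (inner x y) ((inner x y)^* ) => c d a b c0.
  by field.
by rewrite subr_ge0 ler_pdivrMr.
Qed.

Lemma inner_normD x y : inner_norm (x + y) <= inner_norm x + inner_norm y.
Proof.
rewrite -(@ler_pXn2r _ 2)// ?nnegrE ?addr_ge0 ?inner_norm_ge0//.
rewrite inner_norm_sqr sqrrD !inner_norm_sqr !(innerDl, innerDr).
have -> : inner x x + inner y x + (inner x y + inner y y) =
  inner x x + (inner x y + inner y x) + inner y y by ring.
rewrite lerD2r lerD2l.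
have hr : inner x y + inner y x \is Num.real.
  rewrite CrealE rmorphD /= -!inner_conj addrC //.
rewrite (le_trans (real_ler_norm hr))// (le_trans (ler_normD _ _))//.
by rewrite mulr2n lerD// ?inner_le// mulrC inner_le.
Qed.

End PreHilbertTheory.

Section ComplexHilbert.
Variable R : realType.

Let cinner (x y : R[i]) : R[i] := x * y^*.
Let cDl x y z : cinner (x + y) z = cinner x z + cinner y z.
Proof. exact: mulrDl. Qed.
Let cZl a x z : cinner (a *: x) z = a * cinner x z.
Proof. by rewrite /cinner -mulrA. Qed.
Let c_conj x y : cinner y x = (cinner x y)^*.
Proof. by rewrite /cinner rmorphM /= conjCK mulrC. Qed.
Let c_ge0 x : 0 <= cinner x x.
Proof. exact: mul_conjC_ge0. Qed.
Let c_eq0 x : cinner x x = 0 -> x = 0.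
Proof. by move/eqP; rewrite mul_conjC_eq0 => /eqP. Qed.

HB.instance Definition _ :=
  isPreHilbert.Build R R[i] cDl cZl c_conj c_ge0 c_eq0.

Let c_norm (x : R[i]) : `|x| ^+ 2 = inner x x.
Proof. by rewrite normCK. Qed.

HB.instance Definition _ := isHilbert.Build R R[i] c_norm.
End ComplexHilbert.

Section l2Z.
Variable R : realType.
Implicit Types a b c : int -> R[i].

Definition sqmod (z : R[i]) : R := complex.Re z ^+ 2 + complex.Im z ^+ 2.

(* A sum over Z is taken by grouping the indices k and - (k + 1) = Negz k for
   k = 0, 1, 2, ...; for square-summable families the order is irrelevant. *)
Definition l2_term a (k : nat) : R := sqmod (a (Posz k)) + sqmod (a (Negz k)).

Definition l2_pred : {pred int -> R[i]} :=
  fun a => `[< cvgn (series (l2_term a)) >].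

Lemma sqmodE z : (sqmod z)%:C%C = `|z| ^+ 2.
Proof. exact: add_Re2_Im2. Qed.

Lemma sqmod_ge0 z : 0 <= sqmod z.
Proof. by rewrite addr_ge0 ?sqr_ge0. Qed.

Lemma l2_term_ge0 a k : 0 <= l2_term a k.
Proof. by rewrite addr_ge0 ?sqmod_ge0. Qed.

Lemma sqmodD x y : sqmod (x + y) <= 2 * sqmod x + 2 * sqmod y.
Proof.
case: x => a b; case: y => c d; rewrite /sqmod /=.
have := sqr_ge0 (a - c); have := sqr_ge0 (b - d); nra.
Qed.

Lemma sqmodZ x y : sqmod (x * y) = sqmod x * sqmod y.
Proof. by case: x => a b; case: y => c d; rewrite /sqmod /=; ring. Qed.

Lemma l2_nondecreasing a : nondecreasing_seq (series (l2_term a)).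
Proof. by apply: nondecreasing_series => k _ _; exact: l2_term_ge0. Qed.

Lemma l2_bounded a (M : R) :
  (forall n, series (l2_term a) n <= M) -> a \in l2_pred.
Proof.
move=> aM; apply/asboolP/nondecreasing_is_cvgn; first exact: l2_nondecreasing.
by exists M => _ [n _ <-].
Qed.

Lemma l2_series_le a n : a \in l2_pred ->
  series (l2_term a) n <= limn (series (l2_term a)).
Proof.
by move=> /asboolP al2; apply: nondecreasing_cvgn_le => //; exact: l2_nondecreasing.
Qed.

Lemma l2_submod : submod_closed l2_pred.
Proof.
split.
  apply: (@l2_bounded _ 0) => n.
  by rewrite /series /= big1// => k _; rewrite /l2_term /sqmod /= expr0n /= !addr0.
move=> c a b al2 bl2.
apply: (@l2_bounded _ (2 * sqmod c * limn (series (l2_term a)) +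
                       2 * limn (series (l2_term b)))) => n.
apply: (@le_trans _ _ (2 * sqmod c * series (l2_term a) n +
                       2 * series (l2_term b) n)).
  rewrite /series /= !mulr_sumr -big_split /=; apply: ler_sum => k _.
  rewrite /l2_term.
  have := sqmodD (c *: a (Posz k)) (b (Posz k)).
  have := sqmodD (c *: a (Negz k)) (b (Negz k)).
  rewrite !sqmodZ => h1 h2.
  rewrite [X in X <= _](_ : _ = sqmod (c *: a (Posz k) + b (Posz k)) +
    sqmod (c *: a (Negz k) + b (Negz k)))//.
  lra.
by rewrite lerD// ler_wpM2l ?mulr_ge0 ?sqmod_ge0// l2_series_le.
Qed.

HB.instance Definition _ := GRing.isSubmodClosed.Build _ _ l2_pred l2_submod.

Record l2Z := L2Z { l2Z_fun :> int -> R[i]; l2ZP : l2Z_fun \in l2_pred }.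

HB.instance Definition _ := [isSub for l2Z_fun].
HB.instance Definition _ := [Choice of l2Z by <:].
HB.instance Definition _ := [SubChoice_isSubLmodule of l2Z by <:].

Definition dot_term a b (k : nat) : R[i] :=
  a (Posz k) * (b (Posz k))^* + a (Negz k) * (b (Negz k))^*.

Definition l2_inner (a b : l2Z) : R[i] := limn (series (dot_term a b)).

Lemma dot_term_le a b k :
  `|dot_term a b k| <= (l2_term a k + l2_term b k)%:C%C.
Proof.
have mul_le (x y : R[i]) : `|x * y^*| <= (sqmod x + sqmod y)%:C%C.
  rewrite normrM norm_conjC rmorphD /= !sqmodE.
  have rx := normr_real x; have ry := normr_real y.
  have h : 0 <= (`|x| - `|y|) ^+ 2 by rewrite real_exprn_even_ge0// rpredB.
  have h' : 0 <= `|x| * `|y| by rewrite mulr_ge0.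
  rewrite -subr_ge0 (_ : _ - _ = (`|x| - `|y|) ^+ 2 + `|x| * `|y|); last by ring.
  by rewrite addr_ge0.
rewrite (le_trans (ler_normD _ _))// (le_trans (lerD (mul_le _ _) (mul_le _ _)))//.
by rewrite -rmorphD lecR /l2_term addrACA.
Qed.

Lemma is_cvg_dot_term (a b : l2Z) : cvgn (series (dot_term a b)).
Proof.
apply: (complex_series_cvg (dot_term_le a b)).
by apply: is_cvg_seriesD; apply/asboolP; exact: l2ZP.
Qed.

Lemma l2_inner_self (a : l2Z) : l2_inner a a = (limn (series (l2_term a)))%:C%C.
Proof.
apply/cvg_lim => //.
have /asboolP ca := l2ZP a.
have /complex_cvg_real := ca.
apply: cvg_trans; apply: near_eq_cvg; apply: nearW => n.
rewrite /series /= rmorph_sum; apply: eq_bigr => k _.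
by rewrite /dot_term -!normCK -!sqmodE -rmorphD.
Qed.

Let l2_innerDl x y z : l2_inner (x + y) z = l2_inner x z + l2_inner y z.
Proof.
rewrite /l2_inner -limD; [|exact: is_cvg_dot_term..].
congr (limn _); apply/funext => n.
rewrite -[RHS]/(series (dot_term x z) n + series (dot_term y z) n).
rewrite /series /= -big_split /=.
by apply: eq_bigr => k _; rewrite /dot_term /= !mulrDl addrACA.
Qed.

Let l2_innerZl (s : R[i]) x z : l2_inner (s *: x) z = s * l2_inner x z.
Proof.
apply/cvg_lim => //.
have : (fun n => s * series (dot_term x z) n) @ \oo --> s * l2_inner x z.
  by apply: cvgMl_tmp; exact: is_cvg_dot_term.
apply: cvg_trans; apply: near_eq_cvg; apply: nearW => n.
rewrite /series /= mulr_sumr; apply: eq_bigr => k _.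
by rewrite /dot_term /= mulrDr !mulrA.
Qed.

Let l2_inner_conj x y : l2_inner y x = (l2_inner x y)^*.
Proof.
apply/cvg_lim => //.
have := complex_cvg_conj (@is_cvg_dot_term x y).
apply: cvg_trans; apply: near_eq_cvg; apply: nearW => n.
rewrite /series /= rmorph_sum; apply: eq_bigr => k _.
by rewrite /dot_term rmorphD !rmorphM /= !conjCK ![_^* * _]mulrC.
Qed.

Let l2_inner_ge0 (x : l2Z) : 0 <= l2_inner x x.
Proof.
rewrite l2_inner_self lecR (le_trans _ (l2_series_le 0 (l2ZP x)))//.
by rewrite /series /= big_nil.
Qed.

Lemma l2_term_le_inner (x : l2Z) n :
  (series (l2_term x) n)%:C%C <= l2_inner x x.
Proof. by rewrite l2_inner_self lecR l2_series_le ?l2ZP. Qed.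

Lemma l2_sqmod_le_inner (x : l2Z) (m : int) : (sqmod (x m))%:C%C <= l2_inner x x.
Proof.
pose k := match m with Posz k => k | Negz k => k end.
rewrite (le_trans _ (l2_term_le_inner x k.+1))// lecR.
rewrite /series /= big_nat_recr //= (@le_trans _ _ (l2_term x k))//.
  by rewrite /l2_term /k; case: m {k} => k; [rewrite lerDl|rewrite lerDr]; exact: sqmod_ge0.
by rewrite lerDr sumr_ge0// => i _; exact: l2_term_ge0.
Qed.

Let l2_inner_eq0 (x : l2Z) : l2_inner x x = 0 -> x = 0.
Proof.
move=> x0; apply/val_inj/funext => m /=.
have := l2_sqmod_le_inner x m; rewrite x0 sqmodE => h.
by apply/eqP; rewrite -normr_eq0 -sqrf_eq0 eq_le h exprn_ge0.
Qed.

HB.instance Definition _ := isPreHilbert.Build R l2Z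
  l2_innerDl l2_innerZl l2_inner_conj l2_inner_ge0 l2_inner_eq0.

HB.instance Definition _ := Lmodule_isNormed.Build R[i] l2Z
  (@inner_normD R l2Z) (@inner_normZ R l2Z) (@inner_norm0_eq0 R l2Z).

Let l2_sqr_norm_inner (x : l2Z) : `|x| ^+ 2 = inner x x.
Proof. exact: inner_norm_sqr. Qed.

Lemma complex_continuous_part (f : R[i] -> R) : {morph f : x y / x - y} ->
  (forall w, `|f w|%:C%C <= `|w|) -> continuous f.
Proof.
move=> fB fle w; apply/(@cvgrPdist_lt _ _ _ (nbhs w)) => e e0.
rewrite -nbhs_nbhs_norm.
exists e%:C%C; first by rewrite /= ltcR.
by move=> t /= wt; rewrite -ltcR (le_lt_trans _ wt)// -fB.
Qed.

Lemma sqmod_continuous : continuous sqmod.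
Proof.
have cRe : continuous (@complex.Re R).
  by apply: complex_continuous_part; [move=> [? ?] [? ?]|exact: normc_ge_Re].
have cIm : continuous (@complex.Im R).
  by apply: complex_continuous_part; [move=> [? ?] [? ?]|exact: complex_norm_ge_Im].
by move=> z; exact: cvgD (cvgM (cRe z) (cRe z)) (cvgM (cIm z) (cIm z)).
Qed.

Lemma l2_coord_le (x : l2Z) (m : int) : `|x m| <= `|x|.
Proof.
rewrite -(@ler_pXn2r _ 2)// ?nnegrE// -sqmodE l2_sqr_norm_inner.
exact: l2_sqmod_le_inner.
Qed.

Lemma l2_norm_le (x : l2Z) (e : R) : 0 <= e ->
  (forall n, series (l2_term x) n <= e ^+ 2) -> `|x| <= e%:C%C.
Proof.
move=> e0 xe; rewrite -(@ler_pXn2r _ 2)// ?nnegrE ?lecR// l2_sqr_norm_inner.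
rewrite [leLHS]l2_inner_self -rmorphXn lecR.
apply: limr_le; first exact/asboolP/l2ZP.
exact: nearW.
Qed.

Lemma l2_complete (F : set_system l2Z) : ProperFilter F -> cauchy F -> cvg F.
Proof.
move=> FF Fc.
have Fc' := Fc; move/cauchy_ballP : Fc' => Fc'.
pose l m := lim ((fun x : l2Z => x m) @ F).
have cl m : (fun x : l2Z => x m) @ F --> l m.
  apply/cauchy_cvgP/cauchy_ballP => e e0; near_simpl.
  have := Fc' e e0; apply: filterS => -[x y] /=.
  rewrite -!ball_normE /= => xy; rewrite (le_lt_trans _ xy)//.
  exact: (l2_coord_le (x - y) m).
have key (e : R) : 0 < e -> \forall x \near F,
    forall n, series (l2_term (fun m => l m - (x : l2Z) m)) n <= e ^+ 2.
  move=> e0; have := Fc' e%:C%C; rewrite ltcR => /(_ e0)/nearP_dep.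
  apply: filterS => x xF n.
  apply: (@closed_cvg _ _ F FF (fun y : l2Z => series (l2_term (y - x)) n)
    (fun r => r <= e ^+ 2) (@closed_le _ _)).
    apply: filterS xF => y; rewrite -ball_normE /= => xy.
    rewrite -lecR (le_trans (l2_term_le_inner (y - x) n))//.
    rewrite -[leLHS]l2_sqr_norm_inner rmorphXn /=.
    by rewrite ler_pXn2r ?nnegrE ?lecR ?(ltW e0)// distrC (ltW xy).
  rewrite /series /=; elim: n => [|k IHk].
    by under eq_fun do rewrite big_nil; rewrite big_nil; exact: cvg_cst.
  under eq_fun do rewrite big_nat_recr//=; rewrite big_nat_recr//=.
  apply: cvgD => //; apply: cvgD.
    apply: (cvg_comp (fun y : l2Z => y (Posz k) - x (Posz k)) sqmod).
      by apply: cvgB; [exact: cl|exact: cvg_cst].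
    exact: sqmod_continuous.
  apply: (cvg_comp (fun y : l2Z => y (Negz k) - x (Negz k)) sqmod).
    by apply: cvgB; [exact: cl|exact: cvg_cst].
  exact: sqmod_continuous.
have lx (x : l2Z) (e : R) :
    (forall n, series (l2_term (fun m => l m - x m)) n <= e ^+ 2) -> l \in l2_pred.
  move=> /l2_bounded lxP.
  have -> : l = (fun m => l m - x m) + l2Z_fun x.
    by apply/funext => m; rewrite fctE subrK.
  by rewrite rpredD ?l2ZP.
have lP : l \in l2_pred.
  by have /filter_ex[x /lx] := key 1 ltr01.
apply/cvg_ex; exists (L2Z lP); apply/cvgrPdist_le => e e0.
move: (e0); rewrite ltcE /= => /andP[/eqP ei re0].
have -> : e = (complex.Re e)%:C%C by case: (e) ei => ? ? /= ->.
have := key _ re0; apply: filterS => x xF.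
by apply: l2_norm_le; [exact: ltW|exact: xF].
Qed.

HB.instance Definition _ := Uniform_isComplete.Build l2Z l2_complete.

HB.instance Definition _ := isHilbert.Build R l2Z l2_sqr_norm_inner.

Lemma l2_delta_subproof (n : int) : (fun m => (m == n)%:R) \in l2_pred.
Proof.
apply: (@l2_bounded _ 1) => N.
pose k := match n with Posz k => k | Negz k => k end.
have tE i : l2_term (fun m => (m == n)%:R) i = (if i == k then 1 else 0).
  rewrite /l2_term /sqmod /k; case: n {k} => k.
    by rewrite eqz_nat; case: (i == k); rewrite /= ?expr0n ?expr1n /= ?addr0.
  rewrite (_ : (Negz i == Negz k) = (i == k)); last by apply/eqP/eqP => [[]|->].
  by case: (i == k); rewrite /= ?expr0n ?expr1n /= ?addr0 ?add0r.
rewrite /series /= (eq_bigr _ (fun i _ => tE i)) -big_mkcond big_nat1_eq.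
by case: ifP.
Qed.

Definition l2_delta (n : int) : l2Z := L2Z (l2_delta_subproof n).

End l2Z.

HB.mixin Record isStarAlgebra (R : realType) A & GRing.Algebra R[i] A := {
  star : A -> A;
  starK : involutive star;
  starD : {morph star : x y / x + y};
  starZ : forall (c : R[i]) x, star (c *: x) = c^* *: star x;
  starM : forall x y, star (x * y) = star y * star x
}.

(* All algebras are unital and nonzero, as in the algType hierarchy. *)
#[short(type="starAlgType")]
HB.structure Definition StarAlgebra (R : realType) :=
  {A of GRing.Algebra R[i] A & isStarAlgebra R A}.

HB.mixin Record isNormedStarAlgebra (R : realType) A & StarAlgebra R A := {
  anorm : A -> R[i];
  anormD : forall x y, anorm (x + y) <= anorm x + anorm y;
  anormZ : forall (c : R[i]) x, anorm (c *: x) = `|c| * anorm x;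
  anorm0_eq0 : forall x, anorm x = 0 -> x = 0;
  anormM : forall x y, anorm (x * y) <= anorm x * anorm y
}.

#[short(type="normedStarAlgType")]
HB.structure Definition NormedStarAlgebra (R : realType) :=
  {A of StarAlgebra R A & isNormedStarAlgebra R A}.

(* The normed module underlying A is put on an alias: the ring and the normed
   module hierarchies have no common structure that A itself could inherit. *)
Definition normed_space (R : realType) (A : normedStarAlgType R) : Type := A.

Section NormedSpace.
Variables (R : realType) (A : normedStarAlgType R).
HB.instance Definition _ := GRing.Lmodule.copy (normed_space A) A.
HB.instance Definition _ := Lmodule_isNormed.Build R[i] (normed_space A)
  (@anormD R A) (@anormZ R A) (@anorm0_eq0 R A).
End NormedSpace.

HB.mixin Record isCstarAlgebra (R : realType) A & NormedStarAlgebra R A := {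
  cstar_complete : forall F : set_system (@normed_space R A),
    ProperFilter F -> cauchy F -> cvg F;
  cstar_identity : forall x : A, anorm (star x * x) = anorm x ^+ 2
}.

#[short(type="cstarAlgType")]
HB.structure Definition CstarAlgebra (R : realType) :=
  {A of NormedStarAlgebra R A & isCstarAlgebra R A}.

Record starHom (R : realType) (A B : starAlgType R) := StarHom {
  starHom_fun :> {lrmorphism A -> B};
  starHomP : forall x, starHom_fun (star x) = star (starHom_fun x)
}.

Definition disk (R : realType) : set R[i] := [set z | `|z| <= 1].
Arguments disk : clear implicits.

Definition CD (R : realType) := continuousType (disk R) R[i].

Section ContinuousOnDisk.
Variable R : realType.
Local Notation CD := (CD R).
Implicit Types f g h : CD.

HB.instance Definition _ := Choice.on CD.

Lemma CD_eqP f g : (forall z, f z = g z) -> f = g.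
Proof. by move=> fg; apply/continuousEP. Qed.

Let add_cts f g : continuous (fun z => f z + g z).
Proof. by move=> z; apply: (@cvgD _ _ _ (nbhs z)); exact: cts_fun. Qed.
Let opp_cts f : continuous (fun z => - f z).
Proof. by move=> z; apply: (@cvgN _ _ _ (nbhs z)); exact: cts_fun. Qed.
Let mul_cts f g : continuous (fun z => f z * g z).
Proof. by move=> z; apply: (@cvgM _ _ (nbhs z)); exact: cts_fun. Qed.
Let cst_cts (c : R[i]) : continuous (fun _ : disk R => c).
Proof. by move=> z; apply: (@cvg_cst R[i] c (disk R) (nbhs z)). Qed.
Let scale_cts c f : continuous (fun z => c * f z).
Proof.
by move=> z; apply: (@cvgMl_tmp _ _ (nbhs z)); exact: cts_fun.
Qed.
Let conj_cts f : continuous (fun z => (f z)^* ).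
Proof.
move=> z; apply/(@cvgrPdist_lt _ _ _ (nbhs z)) => e e0.
have /(@cvgrPdist_lt _ _ _ (nbhs z))/(_ _ e0) := @cts_fun _ _ f z.
by apply: filterS => t; rewrite -rmorphB norm_conjC.
Qed.

Definition CD_cst c : CD := mkcts (@cst_cts c).
Definition CD_add f g : CD := mkcts (@add_cts f g).
Definition CD_opp f : CD := mkcts (@opp_cts f).
Definition CD_mul f g : CD := mkcts (@mul_cts f g).
Definition CD_scale c f : CD := mkcts (@scale_cts c f).
Definition CD_conj f : CD := mkcts (@conj_cts f).

Let addA : associative CD_add.
Proof. by move=> f g h; apply: CD_eqP => z; exact: addrA. Qed.
Let addC : commutative CD_add.
Proof. by move=> f g; apply: CD_eqP => z; exact: addrC. Qed.
Let add0 : left_id (CD_cst 0) CD_add.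
Proof. by move=> f; apply: CD_eqP => z; exact: add0r. Qed.
Let addN : left_inverse (CD_cst 0) CD_opp CD_add.
Proof. by move=> f; apply: CD_eqP => z; exact: addNr. Qed.
HB.instance Definition _ := GRing.isZmodule.Build CD addA addC add0 addN.

Let mulA : associative CD_mul.
Proof. by move=> f g h; apply: CD_eqP => z; exact: mulrA. Qed.
Let mul1 : left_id (CD_cst 1) CD_mul.
Proof. by move=> f; apply: CD_eqP => z; exact: mul1r. Qed.
Let mulr1' : right_id (CD_cst 1) CD_mul.
Proof. by move=> f; apply: CD_eqP => z; exact: mulr1. Qed.
Let mulDl : left_distributive CD_mul +%R.
Proof. by move=> f g h; apply: CD_eqP => z; exact: mulrDl. Qed.
Let mulDr : right_distributive CD_mul +%R.
Proof. by move=> f g h; apply: CD_eqP => z; exact: mulrDr. Qed.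
Let one_neq0 : CD_cst 1 != 0.
Proof.
have d0 : (0 : R[i]) \in disk R by rewrite inE /disk /= normr0.
apply/eqP => /(congr1 (fun f : CD => f (exist _ 0 d0))).
by apply/eqP; exact: oner_neq0.
Qed.
HB.instance Definition _ :=
  GRing.Zmodule_isNzRing.Build CD mulA mul1 mulr1' mulDl mulDr one_neq0.

Let scaleA a b f : CD_scale a (CD_scale b f) = CD_scale (a * b) f.
Proof. by apply: CD_eqP => z; exact: mulrA. Qed.
Let scale1 : left_id 1 CD_scale.
Proof. by move=> f; apply: CD_eqP => z; exact: mul1r. Qed.
Let scaleDr : right_distributive CD_scale +%R.
Proof. by move=> a f g; apply: CD_eqP => z; exact: mulrDr. Qed.
Let scaleDl f : {morph CD_scale^~ f : a b / a + b}.
Proof. by move=> a b; apply: CD_eqP => z; exact: mulrDl. Qed.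
HB.instance Definition _ :=
  GRing.Zmodule_isLmodule.Build R[i] CD scaleA scale1 scaleDr scaleDl.

Let scaleAl (a : R[i]) f g : a *: (f * g) = a *: f * g.
Proof. by apply: CD_eqP => z; exact: mulrA. Qed.
HB.instance Definition _ := GRing.Lmodule_isLalgebra.Build R[i] CD scaleAl.

Let scaleAr (a : R[i]) f g : a *: (f * g) = f * (a *: g).
Proof. by apply: CD_eqP => z; exact: mulrCA. Qed.
HB.instance Definition _ := GRing.Lalgebra_isAlgebra.Build R[i] CD scaleAr.

Let conjK : involutive CD_conj.
Proof. by move=> f; apply: CD_eqP => z; exact: conjCK. Qed.
Let conjD : {morph CD_conj : f g / f + g}.
Proof. by move=> f g; apply: CD_eqP => z; exact: rmorphD. Qed.
Let conjZ (c : R[i]) f : CD_conj (c *: f) = c^* *: CD_conj f.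
Proof. by apply: CD_eqP => z; exact: rmorphM. Qed.
Let conjM f g : CD_conj (f * g) = CD_conj g * CD_conj f.
Proof. by apply: CD_eqP => z; rewrite [RHS]mulrC; exact: rmorphM. Qed.
HB.instance Definition _ :=
  isStarAlgebra.Build R CD conjK conjD conjZ conjM.

Let coord_cts : continuous (fun z : disk R => \val z).
Proof. exact: (@initial_continuous (disk R) R[i] set_val). Qed.

Definition CD_coord : CD := mkcts coord_cts.

End ContinuousOnDisk.

Record homeo (T : topologicalType) := Homeo {
  homeo_fun :> T -> T;
  homeo_inv : T -> T;
  homeoK : cancel homeo_fun homeo_inv;
  homeoVK : cancel homeo_inv homeo_fun;
  homeo_cts : continuous homeo_fun;
  homeoV_cts : continuous homeo_inv
}.

Definition homeo_iter (T : topologicalType) (phi : homeo T) (n : int) (x : T) : T :=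
  match n with
  | Posz k => iter k phi x
  | Negz k => iter k.+1 (homeo_inv phi) x
  end.

Definition unitary (R : realType) (A : starAlgType R) (u : A) :=
  star u * u = 1 /\ u * star u = 1.

Section CrossedProduct.
Variables (R : realType) (phi : homeo (disk R)).

Let precomp_cts (f : CD R) : continuous (f \o phi).
Proof.
by move=> z; apply: continuous_comp; [exact: homeo_cts|exact: cts_fun].
Qed.

Definition CD_precomp (f : CD R) : CD R := mkcts (@precomp_cts f).

Record covariant_pair (B : starAlgType R) := CovariantPair {
  cov_iota : starHom (CD R) B;
  cov_U : B;
  cov_unitary : unitary cov_U;
  cov_rel : forall f, star cov_U * cov_iota f * cov_U = cov_iota (CD_precomp f)
}.

Definition cstar_subalgebra (B : cstarAlgType R) (S : set B) :=
  [/\ closed (S : set (normed_space B)), S 1, forall (c : R[i]) x y, S x -> S y -> S (c *: x + y),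
      forall x y, S x -> S y -> S (x * y) & forall x, S x -> S (star x)].

Definition generated_by (B : cstarAlgType R) (G : set B) :=
  forall S : set B, cstar_subalgebra S -> G `<=` S -> S = setT.

(* The universal C*-algebra on the generators C(D), U and the relations of a
   covariant pair. The morphism h is unique since B is generated by the pair. *)
Definition is_crossed_product (B : cstarAlgType R) (p : covariant_pair B) :=
  generated_by (range (cov_iota p) `|` [set cov_U p]) /\
  forall (B' : cstarAlgType R) (q : covariant_pair B'),
    exists h : starHom B B',
      (forall f, h (cov_iota p f) = cov_iota q f) /\ h (cov_U p) = cov_U q.

Definition gen_A (B : starAlgType R) (p : covariant_pair B) : B :=
  cov_iota p (CD_coord R).

End CrossedProduct.

(* A *-homomorphism from B to the bounded operators on H; rep_star says that
   rep_op (star b) is the adjoint of rep_op b. It need not preserve 1. *)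
Record representation (R : realType) (B : starAlgType R) (H : hilbertType R) :=
  Representation {
  rep_op :> B -> {linear H -> H};
  rep_bounded : forall b, exists M : R, forall v, `|rep_op b v| <= M%:C%C * `|v|;
  repD : forall b c v, rep_op (b + c) v = rep_op b v + rep_op c v;
  repZ : forall (a : R[i]) b v, rep_op (a *: b) v = a *: rep_op b v;
  repM : forall b c v, rep_op (b * c) v = rep_op b (rep_op c v);
  rep_star : forall b v w, inner (rep_op (star b) v) w = inner v (rep_op b w)
}.

Section Representations.
Variables (R : realType) (B : starAlgType R).

Definition closed_subspace (H : hilbertType R) (S : set H) :=
  [/\ closed S, S 0 & forall (c : R[i]) v w, S v -> S w -> S (c *: v + w)].

(* The first clause excludes the zero representation on a line. *)
Definition irreducible (H : hilbertType R) (pi : representation B H) :=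
  (exists b v, pi b v <> 0) /\
  forall S : set H, closed_subspace S -> (forall b v, S v -> S (pi b v)) ->
    S = [set 0] \/ S = setT.

Definition unitarily_equivalent (H K : hilbertType R)
    (pi : representation B H) (sigma : representation B K) :=
  exists W : {linear H -> K},
    [/\ forall v w, inner (W v) (W w) = inner v w,
        forall k, exists v, W v = k &
        forall b v, W (pi b v) = sigma b (W v)].

End Representations.

Section Conformal.
Variable R : realType.

(* exp (i t) *)
Definition expi (t : R) : R[i] := (cos t +i* sin t)%C.

Definition conformal_automorphism (phi : disk R -> disk R) :=
  exists (theta : R) (z0 : R[i]), `|z0| < 1 /\
    forall z : disk R, \val (phi z) =
      expi (2 * pi * theta) * ((\val z - z0) / (1 - z0^* * \val z)).

Definition hyperbolic (phi : disk R -> disk R) :=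
  conformal_automorphism phi /\
  exists p q : disk R, p <> q /\ [set z | phi z = z] = [set p; q].

End Conformal.

Section Models.
Variables (R : realType) (phi : homeo (disk R)).
Variables (B : starAlgType R) (p : covariant_pair phi B).

Definition is_pi_theta_eps (theta eps : R) (sigma : representation B R[i]) :=
  (forall v, sigma (gen_A p) v = eps%:C%C * v) /\
  (forall v, sigma (cov_U p) v = expi (2 * pi * theta) * v).

Definition is_pi_x (x : disk R) (sigma : representation B (l2Z R)) :=
  forall n : int,
    sigma (gen_A p) (l2_delta R n) =
      (\val (homeo_iter phi n x) : R[i]) *: l2_delta R n /\
    sigma (cov_U p) (l2_delta R n) = l2_delta R (n + 1).

End Models.

(* Main.v *)
Require Import Defs.
From HB Require Import structures.
From mathcomp Require Import all_boot all_order all_algebra.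
From mathcomp Require Import all_classical all_reals all_analysis.
From mathcomp Require Import complex.
From mathcomp Require Import ring lra zify.

Set Implicit Arguments.
Unset Strict Implicit.
Unset Printing Implicit Defensive.

Import Order.TTheory GRing.Theory Num.Theory.
Import numFieldNormedType.Exports.

Local Open Scope classical_set_scope.
Local Open Scope ring_scope.

(** Let rho be an irreducible representation on H; write U for the operator of the
    unitary, and f for the operator of a function f on the disk.  The map phi is z |-> (z - t) / (1 - t z) with t
    real and nonzero, so it multiplies |1 + z|^2 / |1 - z|^2 by a constant
    different from 1: away from the two fixed points, phi pushes every thin
    annulus of this function off itself for good.  Call f wandering when
    f . (f o phi^n) = 0 for all n >= 1.

    The heart of the matter is that irreducibility turns commuting operators
    into scalars on suitable vectors.  If c1 c2 = 0 where c1, c2 commute with the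
    functions, and f is wandering, then c1 f U^n f c2 = 0 for every integer n, so
    that the range of f c2 generates an invariant subspace killed by c1 f; hence
    c1 f = 0 or f c2 = 0 ([corner_dichotomy]).  For a selfadjoint b commuting with
    the functions, apply this to c1 = |b| - b and c2 = |b| + b: on the range of f,
    b equals |b| or - |b|.  Taking b = a - l with l the mean value of a at a vector
    v of that range gives <|b| v, v> = 0, hence |b| v = 0 and a v = l v
    ([selfadjoint_eigen]).  Absolute values come from a square root iteration in
    the algebra itself ([cstar_abs]).

    If some wandering f acts nontrivially, a nonzero vector in its range is then a
    common eigenvector of all functions, that is, evaluation at a point x of the
    disk ([eigencharacter_eval]).  Since f(x) is nonzero, x is not fixed and
    the vectors U^n w, with w the normalized eigenvector, are orthonormal; they
    span H by irreducibility and their coefficients identify rho with pi_x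
    ([orbit_equivalence]).

    If every wandering f acts as 0, continuous step functions of
    |1 + z|^2 / |1 - z|^2 act as projections which do not depend on the place of
    the step and commute with everything; so all of them are 0 or all are 1, and
    every function acts by its value at one of the fixed points
    ([no_wandering_fixed]).  Then U commutes with all of rho, the argument
    above with f = 1 shows that every vector is an eigenvector of U, and H is a line
    ([fixed_point_equivalence]). *)

(** * Dominated series and closed sets *)
Section Convergence.
Variable R : realType.

Lemma posC_real (e : R[i]) : 0 < e -> exists2 r : R, 0 < r & e = r%:C%C.
Proof.
rewrite ltcE /= => /andP[/eqP ei e0]; exists (complex.Re e) => //.
by case: (e) ei => a b /= ->.
Qed.

(** The exponent p covers two uses: absolute convergence (p = 1) and orthogonal
    series, where it is the square of the norm that is additive (p = 2). *)
Lemma series_cvg_dominated (V : completeNormedModType R[i]) (u : nat -> V)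
    (v : nat -> R) (p : nat) :
  (0 < p)%N ->
  (forall m n, `|\sum_(m <= k < n) u k| ^+ p <= (\sum_(m <= k < n) v k)%:C%C) ->
  cvgn (series v) -> cvgn (series u).
Proof.
move=> p0 uv /cauchy_cvgP/cauchy_seriesP cv.
apply/cauchy_cvgP/cauchy_seriesP => _ /posC_real[r r0 ->].
have := cv _ (exprn_gt0 p r0); apply: filterS => n /= Hn.
rewrite -(@ltr_pXn2r _ p)// ?nnegrE ?lecR ?(ltW r0)//.
rewrite (le_lt_trans (uv _ _))// -rmorphXn ltcR.
by rewrite (le_lt_trans _ Hn)// ler_norm.
Qed.

Lemma closed_vanishing (U : topologicalType) (V : normedModType R[i]) (f : U -> V) :
  continuous f -> closed [set x | f x = 0].
Proof.
move=> cf; have c0 : closed [set (0 : V)].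
  by apply: accessible_closed_set1; apply: hausdorff_accessible; exact: norm_hausdorff.
exact: (proj1 (continuous_closedP f) cf _ c0).
Qed.

Lemma closed_equalizer (U : topologicalType) (V : normedModType R[i]) (f g : U -> V) :
  continuous f -> continuous g -> closed [set x | f x = g x].
Proof.
move=> cf cg; rewrite (_ : [set x | f x = g x] = [set x | f x - g x = 0]).
  by apply: closed_vanishing => x; apply: cvgB; [exact: cf|exact: cg].
apply/seteqP; split => x /= => [->|/eqP]; first by rewrite subrr.
by rewrite subr_eq0 => /eqP.
Qed.

Lemma continuous_bounded_linear (U V : normedModType R[i]) (f : U -> V) (k : R[i]) :
  0 <= k -> {morph f : x y / x - y} -> (forall x, `|f x| <= k * `|x|) ->
  continuous f.
Proof.
move=> k0 fB fk x; apply/(@cvgrPdist_lt _ _ _ (nbhs x)) => e e0.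
have k1 : 0 < k + 1 by rewrite ltr_wpDl.
have /(@cvgr_dist_lt _ _ _ _ _) := @cvg_id _ (nbhs x).
move=> /(_ _ (divr_gt0 e0 k1)); apply: filterS => y xy.
rewrite -fB (le_lt_trans (fk _))//.
rewrite (@le_lt_trans _ _ ((k + 1) * `|x - y|))//.
  by rewrite ler_wpM2r// lerDl.
by rewrite mulrC -ltr_pdivlMr.
Qed.

End Convergence.

(** * Square roots in C*-algebras *)
Section StarAlgebra.
Variables (R : realType) (A : starAlgType R).
Implicit Types x : A.

Lemma star0 : star (0 : A) = 0.
Proof. by rewrite -(scale0r (0 : A)) starZ rmorph0 !scale0r. Qed.

Lemma starN x : star (- x) = - star x.
Proof. by rewrite -scaleN1r starZ rmorphN1 scaleN1r. Qed.

Lemma star1 : star (1 : A) = 1.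
Proof. by rewrite -[LHS]mulr1 -{2}(starK 1) -starM mulr1 starK. Qed.

End StarAlgebra.

Section CstarAlgebra.
Variables (R : realType) (B : cstarAlgType R).
Local Notation NB := (normed_space B).
Implicit Types (x y : B).

HB.instance Definition _ := Uniform_isComplete.Build NB (@cstar_complete R B).

Lemma anormE x : anorm x = `|(x : NB)|. Proof. by []. Qed.

Lemma anorm_ge0 x : 0 <= anorm x. Proof. exact: (normr_ge0 (x : NB)). Qed.

Lemma anormN x : anorm (- x) = anorm x.
Proof. by rewrite -scaleN1r anormZ normrN1 mul1r. Qed.

Lemma anorm_star x : anorm (star x) = anorm x.
Proof.
suff le y : anorm y <= anorm (star y).
  by apply/eqP; rewrite eq_le le andbT -{2}(starK x) le.
have [->|y0] := eqVneq (anorm y) 0; first exact: anorm_ge0.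
have yp : 0 < anorm y by rewrite lt_def y0 anorm_ge0.
by rewrite -(ler_pM2r yp) -expr2 -cstar_identity anormM.
Qed.

Lemma anorm1 : anorm (1 : B) = 1.
Proof.
have := cstar_identity (1 : B); rewrite star1 mulr1 => /eqP.
rewrite -subr_eq0 -{1}[anorm 1]mulr1 expr2 -mulrBr mulf_eq0 => /orP[/eqP/anorm0_eq0/eqP|].
  by rewrite oner_eq0.
by rewrite subr_eq0 => /eqP.
Qed.

Lemma star_continuous : continuous (star : NB -> NB).
Proof.
apply: (@continuous_bounded_linear _ NB NB _ 1) => // [x y|x].
  by rewrite starD starN.
by rewrite mul1r -!anormE anorm_star.
Qed.

Lemma closed_anorm_le (r : R[i]) : closed [set x : NB | anorm x <= r].
Proof.
move=> x xc; apply/ler_addgt0Pr => e e0.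
have [y [/= yr]] := xc _ (nbhsx_ballx x e e0).
rewrite -ball_normE /= => xy.
rewrite -(subrK y x) addrC (le_trans (anormD _ _))// lerD//.
exact: ltW.
Qed.

(** A fixed point y of this map satisfies (1 - y)^2 = 1 - x, which makes 1 - y
    a square root of 1 - x. *)
Definition sqrt_step (x y : B) : B := 2^-1 *: (x + y * y).

Fixpoint sqrt_iter (x : B) (n : nat) : B :=
  if n is k.+1 then sqrt_step x (sqrt_iter x k) else 0.

(** The same iteration run on the scalar 1.  Its increments dominate the norms of
    the increments of [sqrt_iter x] as soon as x has norm at most 1, and it is
    bounded by 1; this gives convergence even at norm 1, where the
    iteration is no longer a contraction. *)
Fixpoint sqrt_major (n : nat) : R :=
  if n is k.+1 then 2^-1 * (1 + sqrt_major k * sqrt_major k) else 0.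

Lemma sqrt_major_bound n : 0 <= sqrt_major n <= 1.
Proof. by elim: n => [|n /andP[h1 h2]] /=; [lra|nra]. Qed.

Lemma sqrt_major_nd n : sqrt_major n <= sqrt_major n.+1.
Proof.
have /andP[] := sqrt_major_bound n; move=> /=; set t := sqrt_major n => h1 h2.
have := sqr_ge0 (t - 1); rewrite expr2; lra.
Qed.

Lemma sqrt_major_cvg : cvgn (series (telescope sqrt_major)).
Proof.
apply: nondecreasing_is_cvgn.
  by apply: nondecreasing_series => k _ _; rewrite /telescope subr_ge0 sqrt_major_nd.
exists 1 => _ [n _ <-].
have := eq_sum_telescope sqrt_major n; rewrite add0r => <-.
by have /andP[] := sqrt_major_bound n.
Qed.

Lemma normr_half : `|2^-1 : R[i]| = (2^-1 : R)%:C%C.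
Proof.
rewrite ger0_norm; last by rewrite invr_ge0 ler0n.
by rewrite fmorphV rmorph_nat.
Qed.

Lemma sqrt_iter_le x n : anorm x <= 1 -> anorm (sqrt_iter x n) <= (sqrt_major n)%:C%C.
Proof.
move=> x1; elim: n => [|n IH] /=; first by rewrite anormE (normr0 NB).
rewrite anormZ normr_half rmorphM rmorphD /= ler_pM2l; last by rewrite ltcR; lra.
rewrite (le_trans (anormD _ _))// lerD// (le_trans (anormM _ _))// rmorphM /=.
by rewrite ler_pM ?anorm_ge0.
Qed.

(** y y - z z = y (y - z) + (y - z) z, without any commutation. *)
Lemma anorm_sqrB y z :
  anorm (y * y - z * z) <= anorm (y - z) * (anorm y + anorm z).
Proof.
have -> : y * y - z * z = y * (y - z) + (y - z) * z.
  by rewrite mulrBr mulrBl addrA subrK.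
rewrite (le_trans (anormD _ _))// [leRHS]mulrDr [X in _ <= X + _]mulrC.
by rewrite lerD// anormM.
Qed.

Lemma sqrt_stepB x y z : sqrt_step x y - sqrt_step x z = 2^-1 *: (y * y - z * z).
Proof. by rewrite -scalerBr opprD addrACA subrr add0r. Qed.

Lemma sqrt_iter_step x n : anorm x <= 1 ->
  anorm (sqrt_iter x n.+1 - sqrt_iter x n) <=
  (sqrt_major n.+1 - sqrt_major n)%:C%C.
Proof.
move=> x1; elim: n => [|n IH].
  by rewrite [sqrt_iter x 0]/= [sqrt_major 0]/= !subr0; exact: sqrt_iter_le.
rewrite [sqrt_iter x n.+2]/= [X in _ - X]/= sqrt_stepB anormZ normr_half.
rewrite (_ : _ - _ = 2^-1 * ((sqrt_major n.+1 - sqrt_major n) *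
  (sqrt_major n.+1 + sqrt_major n))); last by rewrite /=; ring.
rewrite !rmorphM /= ler_pM2l; last by rewrite ltcR; lra.
rewrite (le_trans (anorm_sqrB _ _))// ler_pM ?addr_ge0 ?anorm_ge0//.
by rewrite rmorphD; exact: lerD (sqrt_iter_le n.+1 x1) (sqrt_iter_le n x1).
Qed.

Lemma sqrt_iter_cvg x : anorm x <= 1 -> cvgn (sqrt_iter x : nat -> NB).
Proof.
move=> x1.
have -> : (sqrt_iter x : nat -> NB) = series (telescope (sqrt_iter x : nat -> NB)).
  by apply/funext => n; rewrite [LHS](@eq_sum_telescope NB) [X in X + _]/= add0r.
apply: (@series_cvg_dominated R NB _ (telescope sqrt_major) 1) => //.
  move=> m n; rewrite expr1 rmorph_sum.
  rewrite (le_trans (ler_norm_sum _ _ _))//; apply: ler_sum => k _.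
  exact: sqrt_iter_step.
exact: sqrt_major_cvg.
Qed.

(** The last clause transfers properties of the iterates to the limit; it is how
    selfadjointness and commutation of square roots are obtained below. *)
Lemma cstar_sqrt_fixpoint x : anorm x <= 1 -> exists y : B,
  [/\ anorm y <= 1, y = sqrt_step x y &
      forall S : set NB, closed S -> S 0 -> (forall c, S c -> S (sqrt_step x c)) -> S y].
Proof.
move=> x1; have /cvg_ex[y yl] := sqrt_iter_cvg x1; exists (y : B).
have in_closed (S : set NB) : closed S -> S 0 ->
    (forall c, S c -> S (sqrt_step x c)) -> S y.
  move=> cS S0 SS; apply: (closed_cvg S cS _ y yl); apply: nearW.
  by elim=> [|n IH] //=; exact: SS.
have y1 : anorm y <= 1.
  apply: (closed_cvg _ (@closed_anorm_le 1) _ y yl); apply: nearW => n.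
  rewrite /= (le_trans (sqrt_iter_le _ x1))// -[leRHS]/(1%:C%C) lecR.
  by have /andP[] := sqrt_major_bound n.
split => //; apply/eqP; rewrite -subr_eq0; apply/eqP/anorm0_eq0/eqP.
rewrite eq_le anorm_ge0 andbT; apply/ler_addgt0Pr => e e0; rewrite add0r.
have e20 : 0 < e / 2 by rewrite divr_gt0.
have /cvgrPdist_lt/(_ _ e20) := yl.
move=> [N _ yN].
have d1 : anorm (y - sqrt_iter x N) < e / 2 by exact: (yN N (leqnn _)).
have d2 : anorm (y - sqrt_iter x N.+1) < e / 2 by exact: (yN N.+1 (leqnSn _)).
rewrite -(subrK (sqrt_iter x N.+1) y) -addrA (le_trans (anormD _ _))// [e in _ <= e]splitr.
rewrite lerD ?ltW// /= subrK -opprB anormN sqrt_stepB anormZ normr_half.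
rewrite (le_lt_trans _ d1)// fmorphV rmorph_nat.
rewrite ler_pdivrMl ?ltr0n// mulrC (le_trans (anorm_sqrB _ _))// ler_wpM2l ?anorm_ge0//.
rewrite (_ : 2 = 1 + 1)// lerD// (le_trans (sqrt_iter_le _ x1))// -[leRHS]/(1%:C%C) lecR.
by have /andP[] := sqrt_major_bound N.
Qed.

End CstarAlgebra.

Section CstarPositivity.
Variables (R : realType) (B : cstarAlgType R).
Local Notation NB := (normed_space B).
Implicit Types (b c x y : B).

Lemma mul_continuousl c : continuous (fun x : NB => c * (x : B) : NB).
Proof.
apply: (@continuous_bounded_linear _ NB NB _ (anorm c)); first exact: anorm_ge0.
  by move=> x y; rewrite mulrBr.
by move=> x; exact: anormM.
Qed.

Lemma mul_continuousr c : continuous (fun x : NB => (x : B) * c : NB).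
Proof.
apply: (@continuous_bounded_linear _ NB NB _ (anorm c)); first exact: anorm_ge0.
  by move=> x y; rewrite mulrBl.
by move=> x; rewrite mulrC; exact: anormM.
Qed.

Lemma closed_commutant c : closed [set x : NB | (x : B) * c = c * (x : B)].
Proof.
by apply: (@closed_equalizer _ _ NB); [exact: mul_continuousr|exact: mul_continuousl].
Qed.

Lemma closed_selfadjoint : closed [set x : NB | star x = x].
Proof.
by apply: (@closed_equalizer _ _ NB); [exact: star_continuous|move=> x; exact: cvg_id].
Qed.

Lemma conj_half : (2^-1 : R[i])^* = 2^-1.
Proof. by rewrite fmorphV rmorph_nat. Qed.

Lemma cstar_sqrt x : anorm x <= 1 -> exists y : B,
  [/\ anorm y <= 1, (1 - y) * (1 - y) = 1 - x &
      forall S : set NB, closed S -> S 0 -> (forall c, S c -> S (sqrt_step x c)) -> S y].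
Proof.
move=> /cstar_sqrt_fixpoint[y [y1 yE yS]]; exists y; split => //.
have y2 : y + y = x + y * y.
  rewrite -[RHS](scale1r) -(@divff R[i] 2) ?pnatr_eq0// -scalerA -/(sqrt_step x y) -yE.
  by rewrite scaler_nat.
have {}y2 : y * y = y + y - x by rewrite y2 addrC addKr.
by rewrite mulrBl mul1r mulrBr mulr1 opprB y2 [y + y - x]addrAC addrK addrA subrK.
Qed.

(** With d a square root of 1 - b b commuting with b, the element d + i b is
    unitary, so its real part d has norm at most 1. *)
Lemma anorm_sub_sqr b : star b = b -> anorm b <= 1 -> anorm (1 - b * b) <= 1.
Proof.
move=> sb b1.
have [|y [_ yE yS]] := @cstar_sqrt (b * b).
  by rewrite (le_trans (anormM _ _))// mulr_ile1 ?anorm_ge0.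
have sy : star y = y.
  apply: (yS _ closed_selfadjoint) => /=; first exact: star0.
  by move=> c sc; rewrite /sqrt_step starZ conj_half starD !starM sb sc.
have by_ : y * b = b * y.
  apply: (yS _ (@closed_commutant b)) => /=; first by rewrite mul0r mulr0.
  move=> c cb; rewrite /sqrt_step -scalerAl -scalerAr mulrDl mulrDr.
  by rewrite -!mulrA cb (mulrA c b) cb !mulrA.
set d := 1 - y in yE.
have sd : star d = d by rewrite starD star1 starN sy.
have bd : d * b = b * d by rewrite mulrBl mulrBr mul1r mulr1 by_.
clearbody d.
pose u := d + 'i *: b.
have su : star u = d - 'i *: b by rewrite starD sd starZ conjCi sb scaleNr.
have uu : star u * u = 1.
  rewrite su mulrBl !mulrDr -!scalerAl -!scalerAr bd scalerA mulCii scaleN1r.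
  by rewrite opprB [b * b - _]addrC addrA addrK yE subrK.
have u1 : anorm u = 1.
  have := cstar_identity u; rewrite uu anorm1 => /esym/eqP.
  by rewrite sqrf_eq1 => /orP[/eqP//|/eqP u1]; have := anorm_ge0 u; rewrite u1 oppr_ge0 ler10.
have dE : d = 2^-1 *: (u + star u).
  rewrite su addrACA subrr addr0 -mulr2n -[d *+ 2]scaler_nat scalerA mulVf ?scale1r//.
have d1 : anorm d <= 1.
  rewrite dE anormZ ger0_norm ?invr_ge0 ?ler0n// ler_pdivrMl ?ltr0n// mulr1.
  by rewrite (le_trans (anormD _ _))// anorm_star u1.
by rewrite -yE (le_trans (anormM _ _))// mulr_ile1 ?anorm_ge0.
Qed.

(** The element 1 - y is the absolute value of b.  It appears in this form because
    norm y <= 1 is the positivity statement that is used later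
    ([rep_sub1_eq0]). *)
Lemma cstar_abs b : star b = b -> anorm b <= 1 -> exists y : B,
  [/\ anorm y <= 1, (1 - y) * (1 - y) = b * b &
      forall S : set NB, closed S -> S 1 ->
        (forall (a : R[i]) c d, S c -> S d -> S (a *: c + d)) ->
        (forall c d, S c -> S d -> S (c * d)) -> S b -> S (1 - y)].
Proof.
move=> sb b1; have [y [y1 yE yS]] := cstar_sqrt (anorm_sub_sqr sb b1).
exists y; split => //; first by rewrite yE subKr.
move=> S cS S1 SD SM Sb.
have SB c d : S c -> S d -> S (c - d).
  by move=> Sc Sd; rewrite addrC -scaleN1r; exact: SD.
apply: (SB) => //; apply: yS => //; first by rewrite -(subrr 1); exact: SB.
move=> c Sc; rewrite /sqrt_step -[X in S X]addr0; apply: (SD); last first.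
  by rewrite -(subrr 1); exact: SB.
rewrite -[X in S (X + _)]scale1r; apply: (SD) => //; last exact: SM.
by apply: SB => //; exact: SM.
Qed.

End CstarPositivity.

(** * Irreducible representations *)
Section HilbertSpace.
Variables (R : realType) (H : hilbertType R).
Implicit Types (v w : H).

Lemma inner_normE v : inner_norm v = `|v|.
Proof.
apply/eqP; rewrite -(@eqrXn2 _ 2)// ?inner_norm_ge0//.
by rewrite inner_norm_sqr sqr_norm_inner.
Qed.

Lemma cauchy_schwarz v w : `|inner v w| <= `|v| * `|w|.
Proof. by rewrite -!inner_normE inner_le. Qed.

Lemma innerNl v w : inner (- v) w = - inner v w.
Proof. by rewrite -scaleN1r innerZl mulN1r. Qed.

Lemma innerBl x v w : inner (x - v) w = inner x w - inner v w.
Proof. by rewrite innerDl innerNl. Qed.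

Lemma innerNr v w : inner v (- w) = - inner v w.
Proof. by rewrite -scaleN1r innerZr rmorphN1 mulN1r. Qed.

Lemma innerBr x v w : inner x (v - w) = inner x v - inner x w.
Proof. by rewrite innerDr innerNr. Qed.

Lemma inner0l w : inner 0 w = 0 :> R[i].
Proof. by rewrite -(subrr (0 : H)) innerBl subrr. Qed.

Lemma inner0r w : inner w 0 = 0 :> R[i].
Proof. by rewrite -(subrr (0 : H)) innerBr subrr. Qed.

Lemma inner_continuous w : continuous (fun v : H => inner v w : R[i]).
Proof.
apply: (@continuous_bounded_linear _ H R[i] _ `|w|) => // [x y|x].
  exact: innerBl.
by rewrite mulrC cauchy_schwarz.
Qed.

(** Equality case of the Cauchy-Schwarz inequality. *)
Lemma inner_norm1_fix v w : `|w| <= `|v| -> inner w v = inner v v -> w = v.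
Proof.
move=> wv wE; apply/eqP; rewrite -subr_eq0; apply/eqP/inner_eq0/eqP.
rewrite eq_le inner_ge0 andbT innerBl !innerBr wE.
rewrite (inner_conj w v) wE -(inner_conj v v) subrr subr0 -!sqr_norm_inner.
by rewrite subr_le0 ler_pXn2r ?nnegrE.
Qed.

End HilbertSpace.

Section Representation.
Variables (R : realType) (B : cstarAlgType R) (H : hilbertType R).
Variable rho : representation B H.
Hypothesis irr : irreducible rho.
Local Notation NB := (normed_space B).
Implicit Types (b c : B) (v w : H).

Lemma repN b v : rho (- b) v = - rho b v.
Proof. by rewrite -scaleN1r repZ scaleN1r. Qed.

Lemma repB b c v : rho (b - c) v = rho b v - rho c v.
Proof. by rewrite repD repN. Qed.

Lemma rep0 v : rho 0 v = 0.
Proof. by rewrite -(subrr (0 : B)) repB subrr. Qed.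

Lemma rep_continuous b : continuous (rho b).
Proof.
have [M Mb] := rep_bounded rho b.
apply: (@continuous_bounded_linear _ H H _ (`|M%:C%C|)) => // [x y|x].
  by rewrite linearB.
rewrite (le_trans (Mb x))// ler_wpM2r//.
by rewrite normc_def /= expr0n /= addr0 sqrtr_sqr lecR ler_norm.
Qed.

(** The sets S used below are linear conditions on a vector; this turns a check on
    one vector into a statement about operators. *)
Lemma irreducible_full (S : set H) w :
  closed_subspace S -> (forall b v, S v -> S (rho b v)) -> S w -> w != 0 ->
  forall v, S v.
Proof.
move=> cS SS Sw w0 v; have [_ /(_ _ cS SS)[S0|->//]] := irr.
by move: Sw w0; rewrite S0 => ->; rewrite eqxx.
Qed.

Lemma rep1 v : rho 1 v = v.
Proof.
have [[b [w /eqP bw]] _] := irr.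
apply: (irreducible_full (S := [set v | rho 1 v = v]) (w := rho b w)) => //=.
- split => /=; [|by rewrite linear0|by move=> a x y xE yE; rewrite linearP xE yE].
  by apply: closed_equalizer; [exact: rep_continuous|move=> x; exact: cvg_id].
- by move=> c x _; rewrite -repM mul1r.
- by rewrite -repM mul1r.
Qed.

Lemma rep_inner_star b v w : inner (rho b v) w = inner v (rho (star b) w).
Proof. by rewrite -{1}(starK b) rep_star. Qed.

(** If c has norm at most 1 then 1 - c* c is the square of a selfadjoint element,
    hence acts as a positive operator. *)
Lemma rep_contraction b v : `|rho b v| <= anorm b * `|v|.
Proof.
have key c : anorm c <= 1 -> `|rho c v| <= `|v|.
  move=> c1; have [|y [_ yE yS]] := @cstar_sqrt _ _ (star c * c).
    by rewrite cstar_identity exprn_ile1 ?anorm_ge0.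
  have sy : star y = y.
    apply: (yS _ (@closed_selfadjoint _ _)) => /=; first exact: star0.
    by move=> d sd; rewrite /sqrt_step starZ conj_half starD !starM starK sd.
  rewrite -(@ler_pXn2r _ 2) ?nnegrE// !sqr_norm_inner -subr_ge0.
  have <- : inner (rho (1 - y) v) (rho (1 - y) v) =
      inner v v - inner (rho c v) (rho c v).
    rewrite rep_inner_star starD star1 starN sy -repM yE repB rep1 innerBr.
    by rewrite [X in _ = _ - X]rep_inner_star repM.
  exact: inner_ge0.
have [/anorm0_eq0 ->|b0] := eqVneq (anorm b) 0.
  by rewrite rep0 normr0 mulr_ge0// anorm_ge0.
have bp : 0 < anorm b by rewrite lt_def b0 anorm_ge0.
have := key ((anorm b)^-1 *: b); rewrite anormZ ger0_norm ?invr_ge0 ?(ltW bp)// mulVf//.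
move=> /(_ (lexx _)); rewrite repZ normrZ ger0_norm ?invr_ge0 ?(ltW bp)//.
by rewrite ler_pdivrMl.
Qed.

Lemma rep_continuous_arg v : continuous (fun b : NB => rho b v).
Proof.
apply: (@continuous_bounded_linear _ NB H _ `|v|) => // [x y|x].
  by rewrite repB.
by rewrite mulrC rep_contraction.
Qed.

(** An operator 1 - y with norm y <= 1 vanishes at v as soon as its quadratic form
    does, as for a positive operator. *)
Lemma rep_sub1_eq0 y v : anorm y <= 1 -> inner (rho (1 - y) v) v = 0 -> rho (1 - y) v = 0.
Proof.
move=> y1; rewrite repB rep1 innerBl => /eqP; rewrite subr_eq0 => /eqP vy.
rewrite (@inner_norm1_fix _ _ v (rho y v)) ?subrr//.
by rewrite (le_trans (rep_contraction _ _))// ler_piMl.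
Qed.

Lemma closed_rep_stable (S : set H) : closed_subspace S ->
  cstar_subalgebra ([set b | forall v, S v -> S (rho b v) /\ S (rho (star b) v)] : set B).
Proof.
move=> [cS S0 SD]; split => /=.
- move=> b bc v Sv.
  have f1 : closed [set c : NB | S (rho c v)].
    exact: (proj1 (@continuous_closedP NB H (fun c => rho c v)) (@rep_continuous_arg v) S cS).
  have f2 : closed [set c : NB | S (rho (star c) v)].
    apply: (proj1 (@continuous_closedP NB NB (star : NB -> NB)) (@star_continuous _ B) _ f1).
  by split; [apply: f1|apply: f2]; apply: closure_subset bc => c /(_ v Sv)[].
- by move=> v Sv; rewrite star1 rep1.
- move=> a x y Sx Sy v Sv; rewrite starD starZ !repD !repZ.
  by have [? ?] := Sx _ Sv; have [? ?] := Sy _ Sv; split; exact: SD.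
- move=> x y Sx Sy v Sv; rewrite starM !repM.
  by split; [apply: (Sx _ (Sy _ Sv).1).1|apply: (Sy _ (Sx _ Sv).2).2].
- by move=> x Sx v /Sx; rewrite starK => -[].
Qed.

End Representation.

(** * The dichotomy on a wandering corner *)
Section Covariant.
Variables (R : realType) (phi : homeo (disk R)).
Variables (B : cstarAlgType R) (p : covariant_pair phi B).
Local Notation CD := (CD R).
Local Notation NB := (normed_space B).
Local Notation iota := (cov_iota p).
Local Notation u := (cov_U p).
Implicit Types (f g : CD) (b c d : B).

Let precompV_cts (f : CD) : continuous (f \o homeo_inv phi).
Proof.
by move=> z; apply: continuous_comp; [exact: homeoV_cts|exact: cts_fun].
Qed.

Definition CD_precompV (f : CD) : CD := mkcts (@precompV_cts f).

Lemma CD_precompVK : cancel CD_precompV (CD_precomp phi).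
Proof. by move=> f; apply: CD_eqP => z; exact: (congr1 f (homeoK phi z)). Qed.

Lemma CD_mulC f g : f * g = g * f.
Proof. by apply: CD_eqP => z; exact: mulrC. Qed.

Lemma iota_mul_U f : iota f * u = u * iota (CD_precomp phi f).
Proof. by rewrite -cov_rel !mulrA (cov_unitary p).2 mul1r. Qed.

Lemma Ustar_mul_iota f : star u * iota f = iota (CD_precomp phi f) * star u.
Proof. by rewrite -cov_rel -mulrA (cov_unitary p).2 mulr1. Qed.

Lemma U_mul_iota f : u * iota f = iota (CD_precompV f) * u.
Proof. by rewrite iota_mul_U CD_precompVK. Qed.

Lemma iota_mul_Un n f : iota f * u ^+ n = u ^+ n * iota (iter n (CD_precomp phi) f).
Proof.
elim: n f => [|n IH] f; first by rewrite mulr1 mul1r.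
by rewrite exprS mulrA iota_mul_U -mulrA IH mulrA -iterSr.
Qed.

Lemma Ustarn_mul_iota n f :
  star u ^+ n * iota f = iota (iter n (CD_precomp phi) f) * star u ^+ n.
Proof.
elim: n f => [|n IH] f; first by rewrite mulr1 mul1r.
by rewrite exprSr -mulrA Ustar_mul_iota mulrA IH -mulrA -iterSr.
Qed.

Lemma Un_mul_iota n f : exists g, u ^+ n * iota f = iota g * u ^+ n.
Proof.
elim: n f => [|n IH] f; first by exists f; rewrite mulr1 mul1r.
have [g gE] := IH (CD_precompV f); exists g.
by rewrite exprSr -mulrA U_mul_iota mulrA gE -mulrA.
Qed.

Lemma star_iota f : star (iota f) = iota (star f).
Proof. by rewrite starHomP. Qed.

Variables (H : hilbertType R) (rho : representation B H).
Hypothesis irr : irreducible rho.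
Hypothesis gen : generated_by (range iota `|` [set u]).
Implicit Types (v w : H).

Lemma irreducible_generators (S : set H) w : closed_subspace S ->
  (forall f v, S v -> S (rho (iota f) v)) ->
  (forall v, S v -> S (rho u v)) -> (forall v, S v -> S (rho (star u) v)) ->
  S w -> w != 0 -> forall v, S v.
Proof.
move=> cS Sf SU SV; apply: (irreducible_full irr) => // b v Sv.
have G : range iota `|` [set u] `<=`
    [set b | forall v, S v -> S (rho b v) /\ S (rho (star b) v)].
  move=> _ [[f _ <-]|->] x Sx; last by split; [exact: SU|exact: SV].
  by rewrite star_iota; split; exact: Sf.
have E := gen (closed_rep_stable irr cS) G.
have /(_ v Sv)[] // : [set b | forall v, S v -> S (rho b v) /\ S (rho (star b) v)] b.
by rewrite E.
Qed.

Lemma closed_kernel b : closed [set v | rho b v = 0].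
Proof. by apply: closed_vanishing; exact: rep_continuous. Qed.

(** Commutation in the representation: when all functions act as scalars, U commutes
    with them under rho, but not in B. *)
Definition commute_under c d := forall v, rho (c * d) v = rho (d * c) v.

Lemma commute_under_closed_subalgebra d (S := [set c : NB | commute_under c d]) :
  [/\ closed S, S 1,
      forall (a : R[i]) (x y : B), S x -> S y -> S (a *: x + y) &
      forall (x y : B), S x -> S y -> S (x * y)].
Proof.
split.
- rewrite (_ : S = \bigcap_v [set c : NB | rho ((c : B) * d) v = rho (d * (c : B)) v]).
    apply: closed_bigI => v _; apply: (@closed_equalizer _ NB H) => c.
      apply: (@continuous_comp NB NB H (fun c => (c : B) * d) (fun b => rho b v)).
        exact: mul_continuousr.
      exact: rep_continuous_arg.
    apply: (@continuous_comp NB NB H (fun c => d * (c : B)) (fun b => rho b v)).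
      exact: mul_continuousl.
    exact: rep_continuous_arg.
  by apply/seteqP; split => [c cS v _|c cS v]; exact: cS.
- by move=> v; rewrite mul1r mulr1.
- move=> a x y xS yS v.
  by rewrite mulrDl mulrDr -scalerAl -scalerAr !repD !repZ xS yS.
- by move=> x y xS yS v; rewrite -mulrA repM yS -repM (mulrA x) repM xS -repM mulrA.
Qed.

Lemma commute_under_expr c d n : commute_under c d -> commute_under c (d ^+ n).
Proof.
move=> cd; elim: n => [|n IH] v; first by rewrite mulr1 mul1r.
by rewrite exprS [in LHS]mulrA repM cd -repM -[d * c * _]mulrA repM IH -repM mulrA.
Qed.

(** The vectors killed by all c1 f U^n, n in Z, form a closed invariant subspace
    that contains the range of f c2. *)
Lemma corner_dichotomy f c1 c2 :
  (forall g, commute_under c1 (iota g)) ->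
  (forall n v, rho (c1 * iota f * u ^+ n * (iota f * c2)) v = 0 /\
               rho (c1 * iota f * star u ^+ n * (iota f * c2)) v = 0) ->
  (forall v, rho (c1 * iota f) v = 0) \/ (forall v, rho (iota f * c2) v = 0).
Proof.
move=> c1g c12.
case: (pselect (forall v, rho (iota f * c2) v = 0)) => [?|nz]; [by right|left].
have [v0 /eqP w0] : exists v, rho (iota f * c2) v <> 0 by apply/existsNP.
pose S := [set w | forall n, rho (c1 * iota f * u ^+ n) w = 0 /\
                             rho (c1 * iota f * star u ^+ n) w = 0].
suff SH : forall v, S v by move=> v; have [] := SH v 0%N; rewrite mulr1.
apply: (irreducible_generators (w := rho (iota f * c2) v0)) => //.
- split.
  + rewrite (_ : S = \bigcap_n ([set w | rho (c1 * iota f * u ^+ n) w = 0] `&`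
                              [set w | rho (c1 * iota f * star u ^+ n) w = 0])).
      by apply: closed_bigI => n _; apply: closedI; exact: closed_kernel.
    by apply/seteqP; split => [w wS n _|w wS n]; exact: wS.
  + by move=> n; rewrite !linear0.
  + move=> a x y xS yS n; rewrite !linearP (xS n).1 (xS n).2 (yS n).1 (yS n).2.
    by rewrite scaler0 addr0.
- move=> g {}v Sv n.
  have key d g' : rho (c1 * iota f * d) v = 0 ->
      rho (c1 * iota f * (iota g' * d)) v = 0.
    move=> dv; rewrite (_ : _ * _ * _ = c1 * iota g' * (iota f * d)).
      by rewrite repM c1g -repM -mulrA repM (mulrA c1) dv linear0.
    by rewrite -!mulrA (mulrA (iota f)) -rmorphM CD_mulC rmorphM -mulrA.
  split; rewrite -repM -[_ * iota g]mulrA.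
    have [g' ->] := Un_mul_iota n g; apply: key; exact: (Sv n).1.
  by rewrite Ustarn_mul_iota; apply: key; exact: (Sv n).2.
- move=> {}v Sv n; split; rewrite -repM -[_ * u]mulrA.
    by rewrite -exprSr; exact: (Sv n.+1).1.
  case: n => [|n]; first by rewrite mul1r; exact: (Sv 1%N).1.
  by rewrite exprSr -mulrA (cov_unitary p).1 mulr1; exact: (Sv n).2.
- move=> {}v Sv n; split; rewrite -repM -[_ * star u]mulrA; last first.
    by rewrite -exprSr; exact: (Sv n.+1).2.
  case: n => [|n]; first by rewrite mul1r; exact: (Sv 1%N).2.
  by rewrite exprSr -mulrA (cov_unitary p).2 mulr1; exact: (Sv n).1.
- by move=> n; rewrite -!repM; exact: c12.
Qed.

End Covariant.

(** * Eigenvectors of selfadjoint elements *)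
Section Eigenvectors.
Variables (R : realType) (phi : homeo (disk R)).
Variables (B : cstarAlgType R) (p : covariant_pair phi B).
Variables (H : hilbertType R) (rho : representation B H).
Local Notation CD := (CD R).
Local Notation iota := (cov_iota p).
Local Notation u := (cov_U p).
Hypothesis irr : irreducible rho.
Hypothesis gen : generated_by (range iota `|` [set u]).
Implicit Types (f g : CD) (b c d : B) (v w : H).

Definition wandering f := forall n, (0 < n)%N -> f * iter n (CD_precomp phi) f = 0.

(** Let l be the mean value of a at the vector v = rho f v0 and let b be a multiple
    of a - l of norm at most 1.  As (|b| - b) (|b| + b) = 0, the dichotomy gives
    b v = |b| v or b v = - |b| v; both force <|b| v, v> = 0 since <b v, v> = 0, so
    that |b| v = 0 and b v = 0. *)
Lemma selfadjoint_eigen f a v0 : star a = a ->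
  (forall g, commute_under rho a (iota g)) ->
  wandering f \/
    [/\ f = 1, commute_under rho a u & commute_under rho a (star u)] ->
  exists l : R[i], rho a (rho (iota f) v0) = l *: rho (iota f) v0.
Proof.
move=> sa ag fa; set v := rho (iota f) v0.
have [v_0|v_0] := eqVneq v 0; first by exists 0; rewrite v_0 linear0 scaler0.
have vv : inner v v != 0 by apply: contra v_0 => /eqP/inner_eq0 ->.
pose l := inner (rho a v) v / inner v v; exists l.
have lr : l^* = l.
  rewrite /l rmorphM fmorphV /= -!inner_conj; congr (_ / _).
  by rewrite [RHS]rep_inner_star sa.
pose k := anorm (a - l%:A).
have [/anorm0_eq0/eqP|k0] := eqVneq k 0.
  by rewrite subr_eq0 => /eqP ->; rewrite repZ (rep1 irr).
have kp : 0 < k by rewrite lt_def k0 anorm_ge0.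
pose b := k^-1 *: (a - l%:A).
have bE w : rho b w = k^-1 *: (rho a w - l *: w).
  by rewrite repZ repB repZ (rep1 irr).
suff : rho b v = 0.
  by rewrite bE => /eqP; rewrite scaler_eq0 invr_eq0 (negPf k0) subr_eq0 => /eqP.
have bv0 : inner (rho b v) v = 0.
  by rewrite bE innerZl innerBl innerZl divfK// subrr mulr0.
have kr : (k^-1)^* = k^-1 by apply/CrealP; rewrite rpredV; exact: ger0_real (ltW kp).
have sb : star b = b.
  by rewrite starZ starD starN starZ star1 sa lr kr.
have b1 : anorm b <= 1.
  by rewrite anormZ ger0_norm ?invr_ge0 ?(ltW kp)// mulVf.
have comm_b d : commute_under rho a d -> commute_under rho b d.
  move=> ad; have [_ S1 SD _] := commute_under_closed_subalgebra irr d.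
  rewrite /b scalerBr scalerA -scaleNr addrC; apply: (SD) => //.
  by rewrite -[k^-1 *: a]addr0; apply: (SD) => // w; rewrite mul0r mulr0.
clearbody b.
have [y [y1 yE yS]] := cstar_abs sb b1.
have s0 : inner (rho (1 - y) v) v = 0 -> rho (1 - y) v = 0 by exact: rep_sub1_eq0.
set s := 1 - y in yE yS s0; clearbody s.
have comm_s d : commute_under rho a d -> commute_under rho s d.
  move=> /comm_b bd; have [cS S1 SD SM] := commute_under_closed_subalgebra irr d.
  exact: (yS _ cS S1 SD SM).
have sb_comm : s * b = b * s.
  apply: (yS _ (@closed_commutant _ _ b)) => //=.
  - by rewrite mul1r mulr1.
  - by move=> r c d cb db; rewrite mulrDl mulrDr -scalerAl -scalerAr cb db.
  - by move=> c d cb db; rewrite -mulrA db (mulrA c) cb mulrA.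
have c12 : (s - b) * (s + b) = 0.
  by rewrite mulrBl !mulrDr sb_comm yE [b * b + _]addrC subrr.
have comm_pm d e : commute_under rho a d -> commute_under rho (s + e *: b) d.
  move=> ad; have [_ S1 SD SM] := commute_under_closed_subalgebra irr d.
  by rewrite addrC; apply: (SD); [exact: comm_b|exact: comm_s].
have comm_m d : commute_under rho a d -> commute_under rho (s - b) d.
  by move=> /(comm_pm d (-1)); rewrite scaleN1r.
have comm_p d : commute_under rho a d -> commute_under rho (s + b) d.
  by move=> /(comm_pm d 1); rewrite scale1r.
have [||h|h] := @corner_dichotomy _ _ _ _ _ _ irr gen f (s - b) (s + b).
- by move=> g; exact: comm_m.
- move=> n w.
  have e0 d : commute_under rho a d ->
      rho ((s - b) * d * ((s + b) * iota f)) w = 0.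
    move=> ad; rewrite repM comm_m// -repM.
    rewrite (_ : d * (s - b) * ((s + b) * iota f) = d * ((s - b) * (s + b)) * iota f); last by rewrite !mulrA.
    by rewrite c12 mulr0 mul0r (rep0 rho).
  have swap d : rho (d * (iota f * (s + b))) w = rho (d * ((s + b) * iota f)) w.
    by rewrite repM -comm_p// -repM.
  case: fa => [wf|[f1 au av]]; last first.
    rewrite !swap f1 rmorph1 !mulr1.
    by split; [have := e0 (u ^+ n)|have := e0 (star u ^+ n)];
       rewrite f1 rmorph1 mulr1; apply; exact: commute_under_expr.
  case: n => [|n]; first by rewrite !mulr1 !swap; split; exact: e0.
  have uf : iota f * u ^+ n.+1 * iota f = 0.
    by rewrite iota_mul_Un -mulrA -rmorphM CD_mulC wf// rmorph0 mulr0.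
  have vf : iota f * star u ^+ n.+1 * iota f = 0.
    by rewrite -mulrA Ustarn_mul_iota mulrA -rmorphM wf// rmorph0 mul0r.
  have sandwich x y' : (s - b) * iota f * x * (iota f * y') =
      (s - b) * (iota f * x * iota f) * y' by rewrite !mulrA.
  by rewrite !sandwich uf vf mulr0 mul0r (rep0 rho).
- have : rho s v = rho b v.
    by apply/eqP; rewrite -subr_eq0 -repB /v -repM h.
  by move=> E; rewrite -E s0// E.
- have : rho s v = - rho b v.
    by apply/eqP; rewrite -subr_eq0 opprK -repD /v -repM comm_p// h.
  by move=> E; rewrite -[LHS]opprK -E s0 ?oppr0// E innerNl bv0 oppr0.
Qed.

End Eigenvectors.

(** * Functions on the disk acting on vectors *)
Section RealFunctions.
Variable R : realType.
Local Notation CD := (CD R).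
Implicit Types (f g : CD) (F G : disk R -> R).

Lemma real_complex_continuous : continuous (fun r : R => r%:C%C : R[i]).
Proof.
move=> r; apply/(@cvgrPdist_lt _ _ _ (nbhs r)) => _ /posC_real[e e0 ->].
have /(@cvgrPdist_lt _ _ _ (nbhs r))/(_ _ e0) := @cvg_id _ (nbhs r).
by apply: filterS => t; rewrite -rmorphB /= normc_def /= expr0n /= addr0 sqrtr_sqr ltcR.
Qed.

Definition CD_real F (cF : continuous F) : CD :=
  mkcts (fun z => continuous_comp (cF z) (@real_complex_continuous (F z))).

Lemma CD_real_star F (cF : continuous F) : star (CD_real cF) = CD_real cF.
Proof. by apply: CD_eqP => z; exact: conjc_real. Qed.

Let inv_cts f : (forall z, f z != 0) -> continuous (fun z => (f z)^-1).
Proof.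
by move=> f0 z; apply: (@cvgV _ _ (nbhs z)) => //; exact: cts_fun.
Qed.

Lemma CD_nonvanishing_inv f : (forall z, f z != 0) -> exists g, g * f = 1.
Proof.
move=> f0; exists (mkcts (inv_cts f0)); apply: CD_eqP => z.
by rewrite -[LHS]/((f z)^-1 * f z) mulVf.
Qed.

Lemma star_Re_Im (B : starAlgType R) (a : B) : exists a1 a2 : B,
  [/\ star a1 = a1, star a2 = a2 &
      [/\ a = a1 + 'i *: a2, exists r : R[i], a1 = r *: (a + star a) &
          exists r : R[i], a2 = r *: (a - star a)]].
Proof.
exists (2^-1 *: (a + star a)), ((- 'i / 2) *: (a - star a)); split.
- by rewrite starZ conj_half starD starK addrC.
- rewrite starZ rmorphM rmorphN /= conjCi conj_half opprK starD starN starK.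
  by rewrite -opprB scalerN -scaleNr mulNr.
- split; [|by exists 2^-1|by exists (- 'i / 2)].
  rewrite scalerA mulrA mulrN mulCii opprK mul1r -scalerDr addrACA subrr addr0.
  by rewrite -mulr2n -[a *+ 2]scaler_nat scalerA mulVf ?scale1r ?pnatr_eq0.
Qed.

Section Representation.
Variables (phi : homeo (disk R)) (B : cstarAlgType R) (p : covariant_pair phi B).
Variables (H : hilbertType R) (rho : representation B H).
Local Notation iota := (cov_iota p).
Hypothesis irr : irreducible rho.
Implicit Types v w : H.

Lemma iotaZ (c : R[i]) f : iota (c *: f) = c *: iota f.
Proof. exact: linearZ. Qed.

Lemma rep_iota_cst (c : R[i]) v : rho (iota c%:A) v = c *: v.
Proof. by rewrite iotaZ rmorph1 repZ (rep1 irr). Qed.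

Lemma norm_rep_iota f v :
  `|rho (iota f) v| ^+ 2 = inner (rho (iota (star f * f)) v) v.
Proof.
have -> : iota (star f * f) = star (iota f) * iota f by rewrite star_iota rmorphM.
by rewrite sqr_norm_inner repM rep_star.
Qed.

(** The function e^2 - F^2 has a continuous square root, so e^2 - F^2 acts as a
    positive operator. *)
Lemma rep_iota_bound F (cF : continuous F) (e : R) v :
  (forall z, `|F z| <= e) -> `|rho (iota (CD_real cF)) v| <= e%:C%C * `|v|.
Proof.
move=> Fe.
have d0 : (0 : R[i]) \in disk R by rewrite inE /disk /= normr0.
have e0 : 0 <= e := le_trans (normr_ge0 _) (Fe (exist _ 0 d0)).
have cG : continuous (fun z => Num.sqrt (e ^+ 2 - F z ^+ 2)).
  move=> z; apply: (@continuous_comp _ _ _ (fun z => e ^+ 2 - F z ^+ 2) Num.sqrt).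
    apply: (@cvgB _ _ _ (nbhs z)); first exact: cvg_cst.
    by apply: (@cvgM _ _ (nbhs z)); exact: cF.
  exact: sqrt_continuous.
have GE : star (CD_real cG) * CD_real cG =
    (e ^+ 2)%:C%C *: 1 - star (CD_real cF) * CD_real cF.
  rewrite !CD_real_star; apply: CD_eqP => z.
  rewrite -[LHS]/((Num.sqrt (e ^+ 2 - F z ^+ 2))%:C%C * (Num.sqrt (e ^+ 2 - F z ^+ 2))%:C%C).
  rewrite -[RHS]/((e ^+ 2)%:C%C * 1 - (F z)%:C%C * (F z)%:C%C).
  rewrite mulr1 -!rmorphM -rmorphB -!expr2 sqr_sqrtr// subr_ge0.
  by rewrite -(real_normK (num_real (F z))) ler_pXn2r ?nnegrE.
rewrite -(@ler_pXn2r _ 2) ?nnegrE ?mulr_ge0 ?lecR// exprMn -subr_ge0.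
have := exprn_ge0 2 (normr_ge0 (rho (iota (CD_real cG)) v)).
rewrite norm_rep_iota GE rmorphB repB rep_iota_cst innerBl -norm_rep_iota.
by rewrite innerZl -sqr_norm_inner rmorphXn.
Qed.

Lemma iota_eigen_all f v :
  (forall a : B, star a = a -> (exists g, a = iota g) -> exists l : R[i], rho a v = l *: v) ->
  exists l : R[i], rho (iota f) v = l *: v.
Proof.
move=> sa; have [f1 [f2 [s1 s2 [-> _ _]]]] := star_Re_Im f.
have [||l1 E1] := sa (iota f1); [by rewrite star_iota s1|by exists f1|].
have [||l2 E2] := sa (iota f2); [by rewrite star_iota s2|by exists f2|].
exists (l1 + 'i * l2).
by rewrite rmorphD [X in _ + X](iotaZ 'i f2) repD repZ E1 E2 scalerA scalerDl.
Qed.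

(** Let c and l be the eigenvalues of the coordinate function and of f.  The
    function |z - c|^2 + |f - l|^2 annihilates v, so it is not invertible and has a
    zero: c belongs to the disk and f(c) = l. *)
Lemma eigencharacter_eval v : v != 0 ->
  (forall f, exists l : R[i], rho (iota f) v = l *: v) ->
  exists x : disk R, forall f, rho (iota f) v = f x *: v.
Proof.
move=> v0 ev; have [c cE] := ev (CD_coord R).
have key f l : rho (iota f) v = l *: v -> exists z : disk R, \val z = c /\ f z = l.
  move=> fE; apply/not_existsP => no.
  pose g1 := CD_coord R - c%:A; pose g2 := f - l%:A.
  pose k : CD := star g1 * g1 + star g2 * g2.
  have kv : rho (iota k) v = 0.
    rewrite rmorphD !rmorphM repD !repM.
    have -> : rho (iota g1) v = 0.
      by rewrite rmorphB repB rep_iota_cst cE subrr.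
    have -> : rho (iota g2) v = 0.
      by rewrite rmorphB repB rep_iota_cst fE subrr.
    by rewrite !linear0 addr0.
  have [z|g gk] := @CD_nonvanishing_inv k.
    apply/eqP => kz; apply: (no z).
    have : `|\val z - c| ^+ 2 + `|f z - l| ^+ 2 = 0.
      rewrite -kz !normCK.
      rewrite -[RHS]/((\val z - c * 1)^* * (\val z - c * 1) + (f z - l * 1)^* * (f z - l * 1)).
      by rewrite !mulr1 ![_^* * _]mulrC.
    move/eqP; rewrite paddr_eq0 ?exprn_ge0// !sqrf_eq0 !normr_eq0 !subr_eq0.
    by move=> /andP[/eqP ? /eqP ?].
  have := rep1 irr v; rewrite -(rmorph1 iota) -gk rmorphM repM kv linear0 => /esym/eqP.
  by rewrite (negPf v0).
have [x [xc _]] := key _ _ cE; exists x => f.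
have [l fE] := ev f; have [z [zc fz]] := key _ _ fE.
by rewrite fE -fz (_ : z = x)//; apply: val_inj; rewrite zc xc.
Qed.

End Representation.
End RealFunctions.

(** * Step functions and representations without wandering functions *)
Section Step.
Variable R : realType.
Implicit Types (A C b t al : R).

(** A continuous step function of the ratio A / C, going from 0 at ratio 1 to 1 at
    ratio b.  It is homogeneous of degree 0 in (A, C) and its denominator has no
    zero, so that it also makes sense where C = 0. *)
Definition step b A C : R :=
  Num.max 0 (A - C) / (Num.max 0 (A - C) + Num.max 0 (b * C - A)).

Lemma step_den_gt0 b A C : 1 < b -> 0 <= A -> 0 <= C -> 0 < A + C ->
  0 < Num.max 0 (A - C) + Num.max 0 (b * C - A).
Proof.
move=> b1 A0 C0 AC; have [AleC|CltA] := leP A C; last first.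
  by rewrite ltr_pwDl ?le_max ?lexx// lt_max subr_gt0 CltA orbT.
rewrite ltr_wpDl ?le_max ?lexx// lt_max subr_gt0; apply/orP; right.
have : 0 < C by lra.
nra.
Qed.

Lemma step_eq0 b A C : A <= C -> step b A C = 0.
Proof. by move=> AC; rewrite /step (max_l (_ : A - C <= 0)) ?mul0r// subr_le0. Qed.

Lemma step_eq1 b A C : 1 < b -> 0 <= A -> 0 <= C -> 0 < A + C ->
  b * C <= A -> step b A C = 1.
Proof.
move=> b1 A0 C0 AC bCA; have := step_den_gt0 b1 A0 C0 AC; rewrite /step.
rewrite [X in _ + X]max_l ?subr_le0// addr0 => h.
by rewrite divff// gt_eqF.
Qed.

Lemma step_bound b A C : 1 < b -> 0 <= A -> 0 <= C -> 0 < A + C ->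
  0 <= step b A C <= 1.
Proof.
move=> b1 A0 C0 AC; have h := step_den_gt0 b1 A0 C0 AC.
rewrite divr_ge0 ?le_max ?lexx ?(ltW h)//= ler_pdivrMr// mul1r lerDl.
by rewrite le_max lexx.
Qed.

Lemma step_homogeneous b A C t : 0 < t -> step b (t * A) (t * C) = step b A C.
Proof.
move=> t0; have maxM x : Num.max 0 (t * x) = t * Num.max 0 x.
  by rewrite -{1}(mulr0 t) maxr_pMr ?ltW.
rewrite /step mulrCA -!mulrBr !maxM -mulrDr -mulf_div divff ?mul1r//.
by rewrite gt_eqF.
Qed.

Lemma bernoulli_le b n : 1 < b -> 1 + (b - 1) * n%:R <= b ^+ n.
Proof.
move=> b1; elim: n => [|n IH]; first by rewrite mulr0 addr0 expr0.
rewrite exprS (le_trans _ (ler_wpM2l _ IH))//; last by lra.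
have : 0 <= n%:R :> R by [].
rewrite -natr1; move: n%:R => m m0; have := mulr_ge0 (sqr_ge0 (b - 1)) m0; lra.
Qed.

Lemma expr_unbounded b M : 1 < b -> exists n, M < b ^+ n.
Proof.
move=> b1; have h : 0 < b - 1 by lra.
exists (Num.bound `|M / (b - 1)|); rewrite (lt_le_trans _ (bernoulli_le _ b1))//.
have := le_lt_trans (ler_norm _) (archi_boundP (normr_ge0 (M / (b - 1)))).
by rewrite ltr_pdivrMr// mulrC => /lt_trans; apply; rewrite ltrDr.
Qed.

End Step.

(** The ratio A / C vanishes exactly at the zeros of A, is infinite exactly at those
    of C, and is multiplied by a / c = b^2 or b^-2 under phi.  The ratio is never
    formed: the statements are homogeneous in (A, C). *)
Section TwoPoles.
Variables (R : realType) (phi : homeo (disk R)).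
Variables (A C : disk R -> R) (a c b : R).
Hypotheses (cA : continuous A) (cC : continuous C).
Hypotheses (A0 : forall z, 0 <= A z) (C0 : forall z, 0 <= C z).
Hypothesis AC : forall z, 0 < A z + C z.
Hypotheses (a0 : 0 < a) (c0 : 0 < c) (b1 : 1 < b).
Hypothesis acb : a = b ^+ 2 * c \/ c = b ^+ 2 * a.
Hypothesis scaling : forall z, exists2 D, 0 < D &
  D * A (phi z) = a * A z /\ D * C (phi z) = c * C z.

Local Notation CD := (CD R).

Let b0 : 0 < b. Proof. exact: lt_trans ltr01 b1. Qed.

Lemma scaling_iter n z : exists2 D, 0 < D &
  D * A (iter n phi z) = a ^+ n * A z /\ D * C (iter n phi z) = c ^+ n * C z.
Proof.
elim: n => [|n [D D0 [DA DC]]]; first by exists 1 => //=; rewrite !expr0 !mul1r.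
have [E E0 [EA EC]] := scaling (iter n phi z); exists (D * E); first exact: mulr_gt0.
by rewrite /= -!mulrA EA EC !exprS -!mulrA -DA -DC ![D * (_ * _)]mulrCA.
Qed.

Lemma iter_precomp n (f : CD) z : iter n (CD_precomp phi) f z = f (iter n phi z).
Proof. by elim: n z => //= n IH z; rewrite -iterS iterSr -IH. Qed.

(** Under phi^n the ratio A / C is multiplied by (a / c)^n, which moves it by at least
    a factor b^2 and so out of an interval ]al, b^2 al[. *)
Lemma annulus_wandering al (f : CD) : 0 < al ->
  (forall z, f z != 0 -> al * C z < A z < b ^+ 2 * (al * C z)) ->
  wandering phi f.
Proof.
move=> al0 fz n n0; apply: CD_eqP => z.
rewrite -[LHS]/(f z * iter n (CD_precomp phi) f z) iter_precomp -[RHS]/(0 : R[i]).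
apply/eqP; rewrite mulf_eq0; apply/orP.
have [f1|/fz/andP[h1 h2]] := eqVneq (f z) 0; [by left|right].
have [f2|/fz/andP[h3 h4]] := eqVneq (f (iter n phi z)) 0 => //; exfalso.
have [D D0 [DA DC]] := scaling_iter n z.
have h3' : al * (c ^+ n * C z) < a ^+ n * A z.
  by rewrite -DA -DC mulrCA ltr_pM2l.
have h4' : a ^+ n * A z < b ^+ 2 * (al * (c ^+ n * C z)).
  by rewrite -DA -DC (mulrCA al D) (mulrCA _ D) ltr_pM2l.
have Cp : 0 < C z.
  by rewrite lt_def C0 andbT; apply/eqP => E; move: h1 h2; rewrite E !mulr0; lra.
have q1 : b ^+ 2 <= (b ^+ 2) ^+ n.
  by rewrite -[leLHS]expr1 ler_weXn2l// exprn_ege1// ltW.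
have an := exprn_gt0 n a0; have cn := exprn_gt0 n c0.
case: acb => E.
  have aE : a ^+ n = (b ^+ 2) ^+ n * c ^+ n by rewrite -exprMn E.
  suff : b ^+ 2 * (al * (c ^+ n * C z)) <= a ^+ n * A z by rewrite leNgt h4'.
  rewrite (@le_trans _ _ (a ^+ n * (al * C z)))// ?ler_pM2l ?(ltW h1)//.
  rewrite aE -mulrA [c ^+ n * (al * _)]mulrCA.
  by rewrite ler_wpM2r// !mulr_ge0// ltW.
have cE : c ^+ n = (b ^+ 2) ^+ n * a ^+ n by rewrite -exprMn E.
suff : a ^+ n * A z <= al * (c ^+ n * C z) by rewrite leNgt h3'.
rewrite mulrCA (@le_trans _ _ (a ^+ n * (b ^+ 2 * (al * C z))))// ?ler_pM2l ?(ltW h2)//.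
by rewrite mulrA cE ler_pM2r ?mulr_gt0// mulrC ler_pM2r.
Qed.

Let addal_gt0 al z : 0 < al -> 0 < A z + al * C z.
Proof.
move=> al0; have := AC z; have := A0 z; have := C0 z.
rewrite le0r => /orP[/eqP ->|Cp _ _]; first by rewrite mulr0.
by rewrite ltr_wpDl// mulr_gt0.
Qed.

Definition step_fun al (z : disk R) : R := step b (A z) (al * C z).

Lemma step_fun_cts al : 0 < al -> continuous (step_fun al).
Proof.
move=> al0.
have max_cts (F : disk R -> R) : continuous F -> continuous (fun z => Num.max 0 (F z)).
  move=> cF z; apply: (@continuous_max _ _ (fun=> 0) F); [exact: cst_continuous|exact: cF].
have cN : continuous (fun z => Num.max 0 (A z - al * C z)).
  apply: max_cts => z; apply: (@cvgB _ _ _ (nbhs z)); first exact: cA.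
  by apply: (@cvgMl_tmp _ _ (nbhs z)); exact: cC.
have cD : continuous (fun z => Num.max 0 (b * (al * C z) - A z)).
  apply: max_cts => z; apply: (@cvgB _ _ _ (nbhs z)); last exact: cA.
  by do 2 apply: (@cvgMl_tmp _ _ (nbhs z)); exact: cC.
move=> z; apply: (@cvgM _ _ (nbhs z)); first exact: cN.
apply: (@cvgV _ _ (nbhs z)); last by apply: (@cvgD _ _ _ (nbhs z)); [exact: cN|exact: cD].
by rewrite gt_eqF// step_den_gt0// ?mulr_ge0 ?(ltW al0)// addal_gt0.
Qed.

Definition CD_step al (al0 : 0 < al) : CD := CD_real (step_fun_cts al0).

Lemma CD_step_precomp al (al0 : 0 < al) al' (al'0 : 0 < al') :
  c * al = a * al' -> CD_precomp phi (CD_step al0) = CD_step al'0.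
Proof.
move=> E; apply: CD_eqP => z; have [D D0 [DA DC]] := scaling z.
rewrite -[LHS]/((step_fun al (phi z))%:C%C) -[RHS]/((step_fun al' z)%:C%C).
congr (_%:C%C); rewrite /step_fun -(step_homogeneous _ _ _ D0) DA mulrCA DC.
by rewrite [al * _]mulrA [al * c]mulrC E -mulrA step_homogeneous.
Qed.

Variables (B : cstarAlgType R) (p : covariant_pair phi B).
Variables (H : hilbertType R) (rho : representation B H).
Local Notation iota := (cov_iota p).
Local Notation u := (cov_U p).
Hypothesis irr : irreducible rho.
Hypothesis gen : generated_by (range iota `|` [set u]).
Hypothesis no_wandering : forall f, wandering phi f -> forall v, rho (iota f) v = 0.

Let h_bound al z : 0 < al -> 0 <= step_fun al z <= 1.
Proof.
by move=> al0; rewrite step_bound// ?mulr_ge0 ?(ltW al0)// addal_gt0.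
Qed.

Let h_eq0 al z : A z <= al * C z -> step_fun al z = 0.
Proof. exact: step_eq0. Qed.

Let h_eq1 al z : 0 < al -> b * (al * C z) <= A z -> step_fun al z = 1.
Proof.
by move=> al0; apply: step_eq1; rewrite ?mulr_ge0 ?(ltW al0)// addal_gt0.
Qed.

(** The difference of the two steps lives on al < A / C < b^2 al, so it is
    wandering. *)
Lemma rep_step_shift al (al0 : 0 < al) al' (al'0 : 0 < al') v : al' = b * al ->
  rho (iota (CD_step al0)) v = rho (iota (CD_step al'0)) v.
Proof.
move=> E; apply/eqP; rewrite -subr_eq0 -repB -rmorphB; apply/eqP.
apply: no_wandering; apply: (annulus_wandering al0) => z.
rewrite (_ : (CD_step al0 - CD_step al'0) z =
  ((step_fun al z)%:C%C - (step_fun al' z)%:C%C))//.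
have C1 : al * C z <= al' * C z by rewrite E -mulrA ler_peMl ?mulr_ge0 ?(ltW b1) ?(ltW al0).
have [h1|h1] := leP (A z) (al * C z).
  by rewrite h_eq0// h_eq0 ?(le_trans h1)// subrr eqxx.
have [h2|//] := leP (b ^+ 2 * (al * C z)) (A z).
have h3 : b * (al' * C z) <= A z.
  by rewrite E (_ : b * (b * al * C z) = b ^+ 2 * (al * C z))//; ring.
rewrite [step_fun al' z]h_eq1// h_eq1 ?subrr ?eqxx//.
by rewrite (le_trans _ h3)// ler_pM2l// b0.
Qed.

Lemma rep_step_expr n al (al0 : 0 < al) al' (al'0 : 0 < al') v : al' = b ^+ n * al ->
  rho (iota (CD_step al0)) v = rho (iota (CD_step al'0)) v.
Proof.
elim: n al' al'0 => [|n IH] al' al'0 E.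
  congr (rho (iota _) v); apply: CD_eqP => z.
  by rewrite -[LHS]/((step_fun al z)%:C%C) -[RHS]/((step_fun al' z)%:C%C) E mul1r.
have bal0 : 0 < b ^+ n * al by rewrite mulr_gt0// exprn_gt0// b0.
by rewrite (IH _ bal0 erefl); apply: rep_step_shift; rewrite mulrA -exprS.
Qed.

Lemma rep_step_precomp al (al0 : 0 < al) v :
  rho (iota (CD_precomp phi (CD_step al0))) v = rho (iota (CD_step al0)) v.
Proof.
have al'0 : 0 < c * al / a by rewrite !mulr_gt0// invr_gt0.
rewrite (@CD_step_precomp _ al0 _ al'0); last by rewrite [RHS]mulrC divfK// gt_eqF.
case: acb => E; last first.
  by apply/esym/(rep_step_expr (n := 2)); rewrite mulrAC {1}E mulfK// gt_eqF.
apply: (rep_step_expr (n := 2)).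
by rewrite !mulrA -E mulrAC divff ?mul1r// gt_eqF.
Qed.

(** h h - h lives where the step h is neither 0 nor 1, hence is wandering. *)
Lemma rep_step_idem al (al0 : 0 < al) v :
  rho (iota (CD_step al0)) (rho (iota (CD_step al0)) v) = rho (iota (CD_step al0)) v.
Proof.
apply/eqP; rewrite -subr_eq0 -repM -rmorphM -repB -rmorphB; apply/eqP.
apply: no_wandering; apply: (annulus_wandering al0) => z.
rewrite (_ : (CD_step al0 * CD_step al0 - CD_step al0) z =
  ((step_fun al z)%:C%C * (step_fun al z)%:C%C - (step_fun al z)%:C%C))//.
have [h1|h1] := leP (A z) (al * C z); first by rewrite h_eq0// mulr0 subrr eqxx.
have [h2|//] := leP (b ^+ 2 * (al * C z)) (A z).
rewrite h_eq1 ?mulr1 ?subrr ?eqxx// (le_trans _ h2)// expr2 -mulrA ler_pM2l ?b0//.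
by rewrite ler_peMl ?mulr_ge0 ?(ltW b1) ?(ltW al0).
Qed.

Lemma rep_step_dichotomy al (al0 : 0 < al) :
  (forall v, rho (iota (CD_step al0)) v = v) \/
  (forall v, rho (iota (CD_step al0)) v = 0).
Proof.
set h := CD_step al0.
case: (pselect (forall v, rho (iota h) v = 0)) => [?|nz]; [by right|left].
have [v0 /eqP w0] : exists v, rho (iota h) v <> 0 by apply/existsNP.
apply: (irreducible_generators irr gen (S := [set v | rho (iota h) v = v])
  (w := rho (iota h) v0)) => //=.
- split => /=; [|by rewrite linear0|by move=> r x y xE yE; rewrite linearP xE yE].
  by apply: closed_equalizer; [exact: rep_continuous|move=> x; exact: cvg_id].
- by move=> f v vE; rewrite -repM -rmorphM CD_mulC rmorphM repM vE.
- by move=> v vE; rewrite -repM iota_mul_U repM rep_step_precomp vE.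
- by move=> v vE; rewrite -(rep_step_precomp al0) -repM -Ustar_mul_iota repM vE.
- exact: rep_step_idem.
Qed.

Lemma rep_small_eq0 (G : disk R -> R) (cG : continuous G) v :
  (forall e, 0 < e -> exists2 G' : disk R -> R, (forall z, `|G' z| <= e) &
     exists cG' : continuous G', rho (iota (CD_real cG)) v = rho (iota (CD_real cG')) v) ->
  rho (iota (CD_real cG)) v = 0.
Proof.
move=> small; set w := rho _ v.
have [vz|v0] := eqVneq v 0; first by rewrite /w vz linear0.
apply/eqP; apply/negPn/negP => w0.
(* the bound e = |w| / (2 |v|) would give |w| <= |w| / 2 *)
have q0 : 0 < `|w| / `|v| / 2 by rewrite !divr_gt0 ?normr_gt0.
have [r r0 rE] := posC_real q0.
have [G' G'r [cG' E]] := small _ r0.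
have := rep_iota_bound p irr cG' v G'r; rewrite -E -/w -rE.
rewrite mulrAC divfK ?normr_eq0// => /le_lt_trans => /(_ `|w|).
rewrite ltxx => h; suff /h : `|w| / 2 < `|w| by [].
by rewrite ltr_pdivrMr// ltr_pMr ?normr_gt0// ltr1n.
Qed.

Let prod_cts (F G : disk R -> R) : continuous F -> continuous G ->
  continuous (fun z => F z * G z).
Proof. by move=> cF cG z; apply: (@cvgM _ _ (nbhs z)); [exact: cF|exact: cG]. Qed.

Let one_sub_cts (F : disk R -> R) : continuous F -> continuous (fun z => 1 - F z).
Proof. by move=> cF z; apply: (@cvgB _ _ _ (nbhs z)); [exact: cvg_cst|exact: cF]. Qed.

(** If the steps act as 1, then G acts as its product with a step, and this product
    is uniformly small once the step is supported near the zeros of C. *)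
Lemma rep_vanish_pole (G : disk R -> R) (cG : continuous G) (M : R) :
  0 < M -> (forall z, A z <= M) ->
  (forall e, 0 < e -> exists2 d, 0 < d & forall z, C z < d -> `|G z| <= e) ->
  (forall v, rho (iota (CD_step (@ltr01 R))) v = v) ->
  forall v, rho (iota (CD_real cG)) v = 0.
Proof.
move=> M0 AM small P1 v; apply: rep_small_eq0 => e e0.
have [d d0 dG] := small _ e0.
have [n Mb] := expr_unbounded (M / d) b1.
have bn : 0 < b ^+ n by rewrite exprn_gt0// b0.
have cP := prod_cts cG (step_fun_cts bn).
exists (fun z => G z * step_fun (b ^+ n) z).
  move=> z; have [Cd|dC] := ltP (C z) d.
    rewrite normrM -[leRHS]mulr1 ler_pM ?dG//.
    by have /andP[h1 h2] := h_bound z bn; rewrite ger0_norm.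
  rewrite h_eq0 ?mulr0 ?normr0 ?(ltW e0)// (le_trans (AM z))//.
  rewrite (@le_trans _ _ (b ^+ n * d))// ?ler_pM2l//.
  by rewrite -ler_pdivrMr// ltW.
exists cP.
have -> : CD_real cP = CD_real cG * CD_step bn.
  by apply: CD_eqP => z; exact: rmorphM.
rewrite rmorphM repM -(@rep_step_expr n _ ltr01 _ bn) ?mulr1// P1//.
Qed.

(** Symmetric to [rep_vanish_pole]: when the steps act as 0, the complementary steps
    act as 1, and they concentrate near the zeros of A. *)
Lemma rep_vanish_copole (G : disk R -> R) (cG : continuous G) (M : R) :
  0 < M -> (forall z, C z <= M) ->
  (forall e, 0 < e -> exists2 d, 0 < d & forall z, A z < d -> `|G z| <= e) ->
  (forall v, rho (iota (CD_step (@ltr01 R))) v = 0) ->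
  forall v, rho (iota (CD_real cG)) v = 0.
Proof.
move=> M0 CM small P0 v; apply: rep_small_eq0 => e e0.
have [d d0 dG] := small _ e0.
have [n Mb] := expr_unbounded (b * M / d) b1.
have bn : 0 < (b ^+ n)^-1 by rewrite invr_gt0 exprn_gt0// b0.
have cP := prod_cts cG (one_sub_cts (step_fun_cts bn)).
exists (fun z => G z * (1 - step_fun (b ^+ n)^-1 z)).
  move=> z; have [Cd|dC] := ltP (A z) d.
    rewrite normrM -[leRHS]mulr1 ler_pM ?dG//.
    by have /andP[h1 h2] := h_bound z bn; rewrite ger0_norm; lra.
  rewrite h_eq1 ?subrr ?mulr0 ?normr0 ?(ltW e0)//.
  rewrite mulrCA ler_pdivrMl ?exprn_gt0 ?b0//.
  rewrite (@le_trans _ _ (b * M)) ?ler_pM2l ?b0//.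
  rewrite (@le_trans _ _ (b ^+ n * d)) ?ler_pM2l ?exprn_gt0 ?b0//.
  by rewrite -ler_pdivrMr// ltW.
exists cP.
have -> : CD_real cP = CD_real cG * (1 - CD_step bn).
  apply: CD_eqP => z; rewrite -[LHS]/((G z * (1 - step_fun (b ^+ n)^-1 z))%:C%C).
  by rewrite rmorphM rmorphB.
rewrite mulrBr mulr1 rmorphB repB [in X in _ - X]rmorphM repM.
rewrite (@rep_step_expr n _ bn _ ltr01) ?P0 ?linear0 ?addr0//.
by rewrite mulfV// gt_eqF// exprn_gt0// b0.
Qed.

End TwoPoles.

(** * Hyperbolic automorphisms fixing 1 and -1 *)
Section DiskDynamics.
Variable R : realType.
Local Notation CD := (CD R).

Lemma disk_mem (r : R) : `|r| <= 1 -> r%:C%C \in disk R.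
Proof.
move=> r1; rewrite inE /disk /= normc_def /= expr0n /= addr0 sqrtr_sqr.
by rewrite -[leRHS]/(1%:C%C) lecR.
Qed.

Definition disk_real (r : R) (r1 : `|r| <= 1) : disk R :=
  exist (fun z => z \in disk R) _ (disk_mem r1).

Definition sqdist (e : R[i]) (z : disk R) : R := sqmod (\val z - e).

Lemma disk_val_cts : continuous (fun z : disk R => \val z : R[i]).
Proof. exact: (@initial_continuous (disk R) R[i] set_val). Qed.

Lemma sqdist_cts e : continuous (sqdist e).
Proof.
move=> z; apply: (@continuous_comp _ _ _ (fun z : disk R => \val z - e) (@sqmod R)).
  by apply: (@cvgB _ _ _ (nbhs z)); [exact: disk_val_cts|exact: cvg_cst].
exact: sqmod_continuous.
Qed.

Lemma sqmod_real (r : R) : sqmod r%:C%C = r ^+ 2.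
Proof. by rewrite /sqmod /= expr0n addr0. Qed.

Lemma sqdist_le4 (r : R) z : `|r| <= 1 -> sqdist r%:C%C z <= 4.
Proof.
move=> r1; rewrite -lecR sqmodE rmorph_nat.
have z1 : `|\val z| <= 1 by have := set_valP z.
rewrite (_ : 4 = (1 + 1) ^+ 2); last by ring.
rewrite ler_pXn2r ?nnegrE ?addr_ge0// (le_trans (ler_normB _ _))// lerD//.
by have := disk_mem r1; rewrite inE.
Qed.

Lemma sqdist_pos_sum z : 0 < sqdist (-1) z + sqdist 1 z.
Proof.
rewrite /sqdist; case: (\val z) => x y; rewrite /sqmod /=.
have := sqr_ge0 x; have := sqr_ge0 y; rewrite !expr2; lra.
Qed.

Lemma sqdist_small (G : disk R -> R) (q : disk R) : continuous G -> G q = 0 ->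
  forall e, 0 < e -> exists2 d, 0 < d &
    forall z, sqdist (\val q) z < d -> `|G z| <= e.
Proof.
move=> cG Gq e e0.
have /(@cvgrPdist_lt _ _ _ (nbhs q))/(_ _ e0) := cG q.
move=> [_ [[W oW <-] /= Wq] WG].
have : nbhs (\val q : R[i]) W by apply: open_nbhs_nbhs; split.
rewrite -nbhs_ballE => -[_ /= /posC_real[d d0 ->] dW].
exists (d ^+ 2); first by rewrite exprn_gt0.
move=> z zd; have /WG : W (\val z).
  apply: dW; rewrite -ball_normE /= distrC -(@ltr_pXn2r _ 2) ?nnegrE ?normr_ge0 ?lecR ?(ltW d0)//.
  by rewrite -sqmodE -rmorphXn ltcR.
by rewrite Gq sub0r normrN => /ltW.
Qed.

(** Fixing 1 and -1 gives k (1 - z0) = 1 - z0^* and k (1 + z0) = 1 + z0^* for the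
    rotation factor k, so k = 1 and z0 is real.  If z0 were 0, the map would be the
    identity and have more than two fixed points. *)
Lemma hyperbolic_real_form (phi : homeo (disk R)) : hyperbolic phi ->
  (forall z : disk R, \val z = 1 -> phi z = z) ->
  (forall z : disk R, \val z = -1 -> phi z = z) ->
  exists t : R, [/\ t != 0, -1 < t < 1 &
    forall z, \val (phi z) = (\val z - t%:C%C) / (1 - t%:C%C * \val z)].
Proof.
move=> [[th [z0 [z01 phiE]]] [q1 [q2 [_ fixE]]]] fix1 fixN1.
have n1 : `|1 : R| <= 1 by rewrite normr1.
have nN1 : `|-1 : R| <= 1 by rewrite normrN1.
have n0 : `|0 : R| <= 1 by rewrite normr0.
have F1 := fix1 (disk_real n1) erefl.
have FN1 : phi (disk_real nN1) = disk_real nN1 by apply: fixN1; rewrite /= rmorphN1.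
set k := expi (2 * pi * th) in phiE.
have z0c : `|z0^*| < 1 by rewrite norm_conjC.
have d1 : 1 - z0^* != 0.
  by rewrite subr_eq0; apply/eqP => E; move: z0c; rewrite -E normr1 ltxx.
have d2 : 1 + z0^* != 0.
  by rewrite addr_eq0; apply/eqP => E; move: z0c; rewrite -normrN -E normr1 ltxx.
have E1 : k * (1 - z0) = 1 - z0^*.
  have := phiE (disk_real n1); rewrite F1 /= mulr1 => E.
  by move/(congr1 ( *%R^~ (1 - z0^*))) : E; rewrite mul1r -mulrA divfK// => <-.
have E2 : k * (1 + z0) = 1 + z0^*.
  have := phiE (disk_real nN1); rewrite FN1 /= rmorphN1 mulrN1 opprK => E.
  move/(congr1 ( *%R^~ (1 + z0^*))) : E; rewrite mulN1r -mulrA divfK// => E.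
  by apply: oppr_inj; rewrite E -mulrN opprD addrC.
have k1 : k = 1.
  have : 2 * k = 2 * 1.
    rewrite [RHS](_ : _ = (1 - z0^*) + (1 + z0^*)); last by ring.
    by rewrite -E1 -E2; ring.
  by apply: mulfI; rewrite pnatr_eq0.
have z0r : z0^* = z0.
  by move: E2; rewrite k1 mul1r => /addrI.
pose t := complex.Re z0.
have tE : z0 = t%:C%C.
  move: z0r; rewrite /t; case: (z0) => x y [] /eqP.
  by rewrite eq_sym -addr_eq0 -mulr2n mulrn_eq0 /= => /eqP ->.
have form z : \val (phi z) = (\val z - t%:C%C) / (1 - t%:C%C * \val z).
  by rewrite phiE k1 mul1r z0r tE.
exists t; split => //; last first.
  move: z01; rewrite tE normc_def /= expr0n /= addr0 sqrtr_sqr.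
  by rewrite -[ltRHS]/(1%:C%C) ltcR ltr_norml.
apply/eqP => t0.
have fix_all z : q1 = z \/ q2 = z.
  have : [set z | phi z = z] z.
    by apply: val_inj; rewrite form t0 mul0r !subr0 divr1.
  by rewrite fixE => -[->|->]; [left|right].
have neq (x y : R) (x1 : `|x| <= 1) (y1 : `|y| <= 1) : x != y ->
    disk_real x1 <> disk_real y1.
  by move=> /eqP xy /(congr1 val) [].
have h01 := neq _ _ n0 n1 (ltac:(by apply/eqP; lra)).
have h0N := neq _ _ n0 nN1 (ltac:(by apply/eqP; lra)).
have h1N := neq _ _ n1 nN1 (ltac:(by apply/eqP; lra)).
by have [] := fix_all (disk_real n0); have [] := fix_all (disk_real n1);
  have [] := fix_all (disk_real nN1) => ? ? ?; congruence.
Qed.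

End DiskDynamics.

Section FixedPoints.
Variables (R : realType) (phi : homeo (disk R)).
Variables (B : cstarAlgType R) (p : covariant_pair phi B).
Variables (H : hilbertType R) (rho : representation B H).
Local Notation CD := (CD R).
Local Notation iota := (cov_iota p).
Hypothesis irr : irreducible rho.
Hypothesis gen : generated_by (range iota `|` [set cov_U p]).

Lemma sqmod_gt0 (w : R[i]) : w != 0 -> 0 < sqmod w.
Proof. by move=> w0; rewrite -ltcR sqmodE exprn_gt0// normr_gt0. Qed.

(** (1 - t z) (w + 1) = (1 - t) (z + 1) and (1 - t z) (w - 1) = (1 + t) (z - 1). *)
Lemma mobius_scaling (t : R) (z w : disk R) : -1 < t < 1 ->
  \val w = (\val z - t%:C%C) / (1 - t%:C%C * \val z) ->
  exists2 D, 0 < D & D * sqdist (-1) w = (1 - t) ^+ 2 * sqdist (-1) z /\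
                     D * sqdist 1 w = (1 + t) ^+ 2 * sqdist 1 z.
Proof.
move=> t1 wE; have z1 : `|\val z| <= 1 by have := set_valP z.
have tn : `|t%:C%C| < 1 :> R[i].
  rewrite normc_def /= expr0n /= addr0 sqrtr_sqr -[ltRHS]/(1%:C%C) ltcR ltr_norml.
  by case/andP: t1 => -> ->.
have d0 : 1 - t%:C%C * \val z != 0.
  rewrite subr_eq0; apply/eqP => E.
  have : `|t%:C%C * \val z| < 1 by rewrite normrM (le_lt_trans _ tn)// ler_piMr.
  by rewrite -E normr1 ltxx.
exists (sqmod (1 - t%:C%C * \val z)); first exact: sqmod_gt0.
rewrite -!sqmod_real -!sqmodZ wE; split; congr (sqmod _).
  by rewrite rmorphB rmorph1; field.
by rewrite rmorphD rmorph1; field.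
Qed.

(** The two poles are the fixed points.  Once real functions vanishing at q act as 0,
    apply this to |g - g(q)|^2 = k* k, whose quadratic form is the square of the norm
    of the action of k = g - g(q). *)
Lemma no_wandering_fixed (t : R) : t != 0 -> -1 < t < 1 ->
  (forall z, \val (phi z) = (\val z - t%:C%C) / (1 - t%:C%C * \val z)) ->
  (forall f, wandering phi f -> forall v, rho (iota f) v = 0) ->
  exists q : disk R, (\val q = 1 \/ \val q = -1) /\
    forall (g : CD) v, rho (iota g) v = g q *: v.
Proof.
move=> t0 t1 form nw; case/andP: (t1) => t1l t1r.
have n1 : `|1 : R| <= 1 by rewrite normr1.
have nN1 : `|-1 : R| <= 1 by rewrite normrN1.
have vanish q : (forall (G : disk R -> R) (cG : continuous G), G q = 0 ->
    forall v, rho (iota (CD_real cG)) v = 0) ->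
    forall (g : CD) v, rho (iota g) v = g q *: v.
  move=> Gq g v; pose k := g - (g q)%:A.
  have cG : continuous (fun z => sqmod (k z)).
    move=> z; apply: (@continuous_comp _ _ _ k (@sqmod R)); first exact: cts_fun.
    exact: sqmod_continuous.
  have kE : star k * k = CD_real cG.
    by apply: CD_eqP => z; rewrite -[RHS]/((sqmod (k z))%:C%C) sqmodE normCK mulrC.
  have kv : rho (iota k) v = 0.
    apply/inner_eq0; rewrite -sqr_norm_inner norm_rep_iota kE Gq ?inner0l//.
    rewrite (_ : k q = 0); first by rewrite /sqmod /= expr0n addr0.
    by rewrite -[LHS]/(g q - g q * 1) mulr1 subrr.
  apply/eqP; rewrite -subr_eq0 -(rep_iota_cst p irr) -repB -rmorphB.
  exact/eqP.
(* b > 1 is the square root of the larger of a / c and c / a, where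
   a = (1 - t)^2 and c = (1 + t)^2 *)
pose b := if 0 < t then (1 + t) / (1 - t) else (1 - t) / (1 + t).
have p1 : 0 < 1 + t by lra.
have p2 : 0 < 1 - t by lra.
have b1 : 1 < b.
  rewrite /b; case: (ltP 0 t) => ht; rewrite ltr_pdivlMr//; first by lra.
  have : t < 0 by rewrite lt_neqAle t0.
  lra.
have acb : (1 - t) ^+ 2 = b ^+ 2 * (1 + t) ^+ 2 \/ (1 + t) ^+ 2 = b ^+ 2 * (1 - t) ^+ 2.
  by rewrite -!exprMn /b; case: (ltP 0 t) => ht; [right|left]; rewrite divfK// gt_eqF.
have scaling z := mobius_scaling t1 (form z).
have A0 e (z : disk R) : 0 <= sqdist e z := @sqmod_ge0 R (\val z - e).
have bound1 (z : disk R) : sqdist 1 z <= 4 by have := sqdist_le4 z n1; rewrite rmorph1.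
have boundN1 (z : disk R) : sqdist (-1) z <= 4.
  by have := sqdist_le4 z nN1; rewrite rmorphN1.
have sq1 := exprn_gt0 2 p1; have sq2 := exprn_gt0 2 p2.
have [h|h] := rep_step_dichotomy (@sqdist_cts R (-1)) (@sqdist_cts R 1)
  (A0 (-1)) (A0 1) (@sqdist_pos_sum R) sq2 sq1 b1 acb scaling irr gen nw (@ltr01 R).
- exists (disk_real n1); split; first by left.
  apply: vanish => G cG Gq v.
  apply: (@rep_vanish_pole _ _ _ _ _ _ _ (@sqdist_cts R (-1)) (@sqdist_cts R 1)
    (A0 (-1)) (A0 1) (@sqdist_pos_sum R) sq2 sq1 b1 acb scaling _ p _ _ irr nw
    _ cG 4) => //.
  exact: (sqdist_small cG Gq).
- exists (disk_real nN1); split; first by right; rewrite /= rmorphN1.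
  apply: vanish => G cG Gq v.
  apply: (@rep_vanish_copole _ _ _ _ _ _ _ (@sqdist_cts R (-1)) (@sqdist_cts R 1)
    (A0 (-1)) (A0 1) (@sqdist_pos_sum R) sq2 sq1 b1 acb scaling _ p _ _ irr nw
    _ cG 4) => //.
  by have := sqdist_small cG Gq; rewrite /= rmorphN1.
Qed.

End FixedPoints.

(** * Unitary equivalence with the sequence space *)
Section Transport.
Variables (R : realType) (B : starAlgType R) (H K : hilbertType R).
Variables (rho : representation B H) (W : {linear H -> K}) (V : K -> H).
Hypothesis W_inner : forall v w, inner (W v) (W w) = inner v w.
Hypothesis VK : cancel V W.

Lemma isometry_norm v : `|W v| = `|v|.
Proof. by rewrite -!inner_normE /inner_norm W_inner. Qed.

Lemma isometry_inj : injective W.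
Proof.
move=> v w vw; apply/eqP; rewrite -subr_eq0 -normr_eq0 -isometry_norm.
by rewrite linearB vw subrr normr0.
Qed.

Definition transport_op b (k : K) : K := W (rho b (V k)).

Lemma transport_op_linear b : linear (transport_op b).
Proof.
move=> a x y; rewrite /transport_op.
have -> : V (a *: x + y) = a *: V x + V y.
  by apply: isometry_inj; rewrite linearP !VK.
by rewrite !linearP.
Qed.

HB.instance Definition _ b :=
  @GRing.isLinear.Build R[i] K K _ (transport_op b) (transport_op_linear b).

Lemma transport_rep : exists sigma : representation B K,
  forall b v, W (rho b v) = sigma b (W v).
Proof.
have V_norm k : `|V k| = `|k| by rewrite -isometry_norm VK.
have WK v : V (W v) = v by apply: isometry_inj; rewrite VK.
have bnd b : exists M : R, forall v, `|transport_op b v| <= M%:C%C * `|v|.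
  have [M Mb] := rep_bounded rho b; exists M => v.
  by rewrite isometry_norm -V_norm.
unshelve eexists; first apply: (@Representation R B K
    (fun b => transport_op b : {linear K -> K}) bnd).
- by move=> b c v; rewrite /= /transport_op repD linearD.
- by move=> a b v; rewrite /= /transport_op repZ linearZ.
- by move=> b c v; rewrite /= /transport_op repM WK.
- by move=> b v w; rewrite /= /transport_op -[in LHS](VK w) W_inner rep_star -[in RHS](VK v) W_inner.
- by move=> b v; rewrite /= /transport_op WK.
Qed.

End Transport.

Section OrthonormalBasis.
Variables (R : realType) (H : hilbertType R) (eps : int -> H).
Hypothesis orthonormal : forall m n, inner (eps m) (eps n) = (m == n)%:R.
Hypothesis total : forall v, (forall n, inner v (eps n) = 0) -> v = 0.
Implicit Types (c : int -> R[i]) (v w : H).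

Lemma inner_suml (I : Type) (r : seq I) (P : pred I) (F : I -> H) w :
  inner (\sum_(i <- r | P i) F i) w = \sum_(i <- r | P i) inner (F i) w.
Proof.
by apply: (big_morph (fun v => inner v w)) => [x y|]; rewrite ?innerDl ?inner0l.
Qed.

(** The partial sums follow the grouping of the indices n and - n - 1 that the inner
    product of the sequence space uses. *)
Definition block c (k : nat) : H := c (Posz k) *: eps (Posz k) + c (Negz k) *: eps (Negz k).

Lemma inner_block c k n : inner (block c k) (eps n) =
  c (Posz k) * (Posz k == n)%:R + c (Negz k) * (Negz k == n)%:R.
Proof. by rewrite innerDl !innerZl !orthonormal. Qed.

Lemma inner_block_self c k : inner (block c k) (block c k) = (l2_term c k)%:C%C.
Proof.
rewrite innerDr !innerZr !inner_block !eqxx /= !mulr0 !mulr1 addr0 add0r.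
by rewrite /l2_term [RHS]rmorphD /= !sqmodE !normCK ![_^* * _]mulrC.
Qed.

Lemma inner_block_neq c k j : k != j -> inner (block c k) (block c j) = 0.
Proof.
move=> kj; rewrite innerDr !innerZr !inner_block /= eqz_nat (negPf kj).
rewrite (_ : (Negz k == Negz j) = false); last first.
  by apply/eqP => -[E]; rewrite E eqxx in kj.
by rewrite !(mulr0, addr0).
Qed.

Lemma norm_block_sum c m n :
  `|\sum_(m <= k < n) block c k| ^+ 2 = (\sum_(m <= k < n) l2_term c k)%:C%C.
Proof.
have [nm|/ltnW mn] := leqP n m; first by rewrite !big_geq// normr0 expr0n.
rewrite sqr_norm_inner -(subnKC mn); elim: (n - m)%N => [|d IH].
  by rewrite addn0 !big_geq// inner0l.
have pythagoras (x y : H) : inner x y = 0 ->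
    inner (x + y) (x + y) = inner x x + inner y y.
  by move=> xy; rewrite innerDl !innerDr (inner_conj x y) xy rmorph0 addr0 add0r.
rewrite addnS !big_nat_recr ?leq_addr//= [RHS]rmorphD /= -IH pythagoras.
  by rewrite inner_block_self.
rewrite inner_suml big_nat_cond big1// => i /andP[/andP[_ id] _].
by rewrite inner_block_neq// ltn_eqF.
Qed.

Lemma block_series_cvg c : c \in @l2_pred R -> cvgn (series (block c)).
Proof.
move=> /asboolP cl; apply: (@series_cvg_dominated R H _ (l2_term c) 2) => //.
by move=> m n; rewrite norm_block_sum.
Qed.

Definition synthesis c : H := limn (series (block c)).

Lemma synthesis_inner c w : c \in @l2_pred R ->
  series (fun k => inner (block c k) w) @ \oo --> inner (synthesis c) w.
Proof.
move=> /block_series_cvg cl.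
rewrite (_ : series _ = (fun n => inner (series (block c) n) w)).
  exact: (continuous_cvg _ (@inner_continuous _ _ w (synthesis c)) cl).
by apply/funext => n; rewrite [RHS]inner_suml.
Qed.

Lemma synthesis_coord c n : c \in @l2_pred R -> inner (synthesis c) (eps n) = c n.
Proof.
move=> cl; have /cvg_lim <- // := @synthesis_inner c (eps n) cl; apply/cvg_lim => //.
pose k0 := match n with Posz k => k | Negz k => k end.
have termE k : inner (block c k) (eps n) = if k == k0 then c n else 0.
  rewrite inner_block /k0; case: n {k0} => n.
    rewrite eqz_nat /= mulr0 addr0; have [->|_] := eqVneq k n; first by rewrite mulr1.
    by rewrite mulr0.
  rewrite /= mulr0 add0r (_ : (Negz k == Negz n) = (k == n)); last first.
    by apply/eqP/eqP => [[]|->].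
  have [->|_] := eqVneq k n; first by rewrite mulr1.
  by rewrite mulr0.
apply: (cvg_near_cst (c n)); exists k0.+1 => // N /= kN.
rewrite /series /= (eq_bigr _ (fun i _ => termE i)) -big_mkcond big_nat1_eq.
by rewrite kN.
Qed.

Definition coords v : int -> R[i] := fun n => inner v (eps n).

Lemma inner_block_coords v w k :
  inner (block (coords v) k) w = dot_term (coords v) (coords w) k.
Proof.
by rewrite innerDl !innerZl /dot_term /coords -!(inner_conj w).
Qed.

(** Bessel's inequality. *)
Lemma coords_l2 v : coords v \in @l2_pred R.
Proof.
apply: (@l2_bounded _ _ (complex.Re (`|v| ^+ 2))) => n.
set c := coords v; pose S := \sum_(0 <= k < n) block c k.
have SS : inner S S = (\sum_(0 <= k < n) l2_term c k)%:C%C.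
  by rewrite -sqr_norm_inner norm_block_sum.
have Sv : inner S v = (\sum_(0 <= k < n) l2_term c k)%:C%C.
  rewrite inner_suml rmorph_sum; apply: eq_bigr => k _.
  by rewrite inner_block_coords /dot_term -!normCK -!sqmodE -rmorphD.
have := inner_ge0 (v - S); rewrite innerBl !innerBr SS Sv (inner_conj S v) Sv.
rewrite (_ : (_%:C%C)^* = (\sum_(0 <= k < n) l2_term c k)%:C%C :> R[i]); last exact: conjc_real.
rewrite subrr subr0 subr_ge0 -sqr_norm_inner lecE /=.
by case/andP.
Qed.

Definition analysis v : l2Z R := L2Z (coords_l2 v).

Lemma synthesis_analysis v : synthesis (coords v) = v.
Proof.
apply/eqP; rewrite -subr_eq0; apply/eqP/total => n.
by rewrite innerBl synthesis_coord ?coords_l2// subrr.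
Qed.

Lemma analysis_linear : linear analysis.
Proof.
move=> a v w; apply: val_inj; apply/funext => n /=.
by rewrite /coords innerDl innerZl.
Qed.

HB.instance Definition _ :=
  @GRing.isLinear.Build R[i] H (l2Z R) _ analysis analysis_linear.

Lemma analysis_inner v w : inner (analysis v) (analysis w) = inner v w.
Proof.
rewrite -[in RHS](synthesis_analysis v); apply/cvg_lim => //.
have := @synthesis_inner (coords v) w (coords_l2 v).
by under eq_fun do rewrite inner_block_coords.
Qed.

Lemma analysis_synthesis (a : l2Z R) : analysis (synthesis a) = a.
Proof.
apply: val_inj; apply/funext => n; exact: synthesis_coord (l2ZP a).
Qed.

Lemma analysis_eps n : analysis (eps n) = l2_delta R n.
Proof.
by apply: val_inj; apply/funext => m /=; rewrite /coords orthonormal eq_sym.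
Qed.

End OrthonormalBasis.

(** * The two kinds of irreducible representations *)
Section OrbitRepresentation.
Variables (R : realType) (phi : homeo (disk R)).
Variables (B : cstarAlgType R) (p : covariant_pair phi B).
Variables (H : hilbertType R) (rho : representation B H).
Local Notation CD := (CD R).
Local Notation iota := (cov_iota p).
Local Notation u := (cov_U p).
Hypothesis irr : irreducible rho.
Hypothesis gen : generated_by (range iota `|` [set u]).
Variables (f : CD) (x : disk R) (w : H).
Hypothesis f_wandering : wandering phi f.
Hypothesis fx : f x != 0.
Hypothesis w1 : inner w w = 1.
Hypothesis wx : forall g : CD, rho (iota g) w = g x *: w.

Definition orbit_vector (n : int) : H :=
  match n with
  | Posz k => rho (u ^+ k) w
  | Negz k => rho (star u ^+ k.+1) w
  end.

Lemma orbit_vectorS n : rho u (orbit_vector n) = orbit_vector (n + 1).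
Proof.
case: n => [k|k] /=; first by rewrite -repM -exprS addn1.
rewrite -repM exprS mulrA (cov_unitary p).2 mul1r NegzE -addn1 PoszD opprD subrK.
by case: k => [|k]; rewrite ?oppr0// -NegzE.
Qed.

Lemma orbit_vector_star n : rho (star u) (orbit_vector (n + 1)) = orbit_vector n.
Proof.
by rewrite -orbit_vectorS -repM (cov_unitary p).1 (rep1 irr).
Qed.

Lemma homeo_iterS n : homeo_iter phi (n + 1) x = phi (homeo_iter phi n x).
Proof.
case: n => [k|k]; first by rewrite /= addn1.
rewrite /= homeoVK NegzE -addn1 PoszD opprD subrK.
by case: k => [|k]; rewrite ?oppr0// -NegzE.
Qed.

Lemma orbit_vector_eigen n (g : CD) :
  rho (iota g) (orbit_vector n) = g (homeo_iter phi n x) *: orbit_vector n.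
Proof.
have up m : (forall g : CD, rho (iota g) (orbit_vector m) =
      g (homeo_iter phi m x) *: orbit_vector m) ->
    forall g : CD, rho (iota g) (orbit_vector (m + 1)) =
      g (homeo_iter phi (m + 1) x) *: orbit_vector (m + 1).
  move=> IH {}g; rewrite -orbit_vectorS -repM iota_mul_U repM IH linearZ.
  by rewrite homeo_iterS.
have down m : (forall g : CD, rho (iota g) (orbit_vector (m + 1)) =
      g (homeo_iter phi (m + 1) x) *: orbit_vector (m + 1)) ->
    forall g : CD, rho (iota g) (orbit_vector m) =
      g (homeo_iter phi m x) *: orbit_vector m.
  move=> IH {}g; rewrite -orbit_vector_star -(CD_precompVK phi g) -repM.
  rewrite -Ustar_mul_iota repM IH linearZ homeo_iterS.
  congr (_ *: _); exact: (congr1 g (esym (homeoK phi _))).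
elim: n g => [|n IH|n IH] g.
- by rewrite /= (rep1 irr).
- by rewrite -addn1 PoszD; apply: up.
- apply: down => {}g; rewrite -addn1 PoszD opprD subrK; exact: IH.
Qed.

(** f has the eigenvalue f(x) <> 0 at w and f(phi^k x) = 0 at U^k w. *)
Lemma wandering_orthogonal k : (0 < k)%N -> inner w (rho (u ^+ k) w) = 0.
Proof.
move=> k0; have fk : f (iter k phi x) = 0.
  have := congr1 (fun g : CD => g x) (f_wandering k0).
  rewrite -[LHS]/(f x * iter k (CD_precomp phi) f x) iter_precomp => /eqP.
  by rewrite mulf_eq0 (negPf fx) => /eqP.
have : f x * inner w (rho (u ^+ k) w) = 0.
  rewrite -innerZl -wx rep_inner_star star_iota.
  have -> : rho (iota (star f)) (rho (u ^+ k) w) = 0.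
    rewrite (orbit_vector_eigen (Posz k)).
    rewrite (_ : star f _ = 0) ?scale0r//.
    by rewrite -[LHS]/((f (iter k phi x))^*) fk rmorph0.
  by rewrite inner0r.
by move/eqP; rewrite mulf_eq0 (negPf fx) => /eqP.
Qed.

Lemma rep_U_inner v v' : inner (rho u v) (rho u v') = inner v v'.
Proof. by rewrite rep_inner_star -repM (cov_unitary p).1 (rep1 irr). Qed.

Lemma orbit_orthonormal m n : inner (orbit_vector m) (orbit_vector n) = (m == n)%:R.
Proof.
have shift k m' n' : inner (orbit_vector (m' + Posz k)) (orbit_vector (n' + Posz k)) =
    inner (orbit_vector m') (orbit_vector n').
  elim: k => [|k IH]; first by rewrite !addr0.
  by rewrite -addn1 PoszD !addrA -!orbit_vectorS rep_U_inner.
have pos a b : inner (orbit_vector (Posz a)) (orbit_vector (Posz b)) = (a == b)%:R.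
  wlog ab : a b / (a <= b)%N.
    move=> wl; have [/wl//|/ltnW/wl E] := leqP a b.
    by rewrite inner_conj E rmorph_nat eq_sym.
  rewrite -(subnK ab) -[X in Posz X]add0n !PoszD shift.
  have [E|ne] := eqVneq a b.
    by rewrite E subnn /= (rep1 irr) w1 add0n eqxx.
  rewrite /= (rep1 irr) wandering_orthogonal ?subn_gt0 ?ltn_neqAle ?ne//.
  by rewrite subnK// (negPf ne).
(* shift both indices by k to make them nonnegative *)
pose k := (`|m| + `|n|)%N.
have [m' mE] : exists m', m + Posz k = Posz m' by exists (absz (m + Posz k)); lia.
have [n' nE] : exists n', n + Posz k = Posz n' by exists (absz (n + Posz k)); lia.
rewrite -(shift k) mE nE pos; congr (nat_of_bool _)%:R.
by rewrite -eqz_nat -mE -nE (inj_eq (addIr _)).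
Qed.

(** The orthogonal complement of the orbit is a closed invariant subspace that does not
    contain w. *)
Lemma orbit_total v : (forall n, inner v (orbit_vector n) = 0) -> v = 0.
Proof.
move=> v0; apply/eqP; apply/negPn/negP => vn0.
suff /(_ w (Posz 0)) : forall v n, inner v (orbit_vector n) = 0.
  by rewrite /= (rep1 irr) w1 => /eqP; rewrite oner_eq0.
apply: (irreducible_generators irr gen
  (S := [set v | forall n, inner v (orbit_vector n) = 0]) (w := v)) => //=.
- split => /= [|n|a y z yS zS n].
  + rewrite (_ : [set v | _] = \bigcap_n [set v | inner v (orbit_vector n) = 0]).
      apply: closed_bigI => n _; apply: (@closed_vanishing _ H R[i]).
      exact: inner_continuous.
    by apply/seteqP; split => [y yS n _|y yS n]; exact: yS.
  + exact: inner0l.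
  + by rewrite innerDl innerZl yS zS mulr0 addr0.
- move=> g y yS n; rewrite rep_inner_star star_iota orbit_vector_eigen innerZr yS.
  by rewrite mulr0.
- move=> y yS n; rewrite rep_inner_star -(subrK 1 n) orbit_vector_star; exact: yS.
- by move=> y yS n; rewrite rep_star orbit_vectorS; exact: yS.
Qed.

Lemma orbit_equivalence : exists sigma : representation B (l2Z R),
  is_pi_x p x sigma /\ unitarily_equivalent rho sigma.
Proof.
pose W : {linear H -> l2Z R} := analysis orbit_orthonormal.
have W_inner := analysis_inner orbit_orthonormal orbit_total.
have WK (a : l2Z R) := analysis_synthesis orbit_orthonormal a.
have [sigma sE] := @transport_rep R B H (l2Z R) rho W _ W_inner WK.
exists sigma; split; last first.
  by exists W; split => // k; eexists; exact: WK.
have We n : W (orbit_vector n) = l2_delta R n := analysis_eps orbit_orthonormal n.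
move=> n; rewrite -We -!sE orbit_vector_eigen linearZ; split => //.
by rewrite orbit_vectorS We.
Qed.

End OrbitRepresentation.

Section FixedPointRepresentation.
Variables (R : realType) (phi : homeo (disk R)).
Variables (B : cstarAlgType R) (p : covariant_pair phi B).
Variables (H : hilbertType R) (rho : representation B H).
Local Notation CD := (CD R).
Local Notation iota := (cov_iota p).
Local Notation u := (cov_U p).
Hypothesis irr : irreducible rho.
Hypothesis gen : generated_by (range iota `|` [set u]).

Lemma unit_vector : exists v : H, inner v v = 1.
Proof.
have [[b [v /eqP bv]] _] := irr.
have v0 : v != 0 by apply: contra_neq bv => ->; rewrite linear0.
exists (`|v|^-1 *: v); rewrite -sqr_norm_inner normrZ normfV normr_id mulVf ?expr1n//.
by rewrite normr_eq0.
Qed.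

Lemma expi_surjective (z : R[i]) : `|z| = 1 ->
  exists2 t : R, 0 <= t < 1 & expi (2 * pi * t) = z.
Proof.
case: z => a b; rewrite normc_def /= => -[s1].
have ab : a ^+ 2 + b ^+ 2 = 1.
  by rewrite -[LHS]sqr_sqrtr ?addr_ge0 ?sqr_ge0// s1 expr1n.
have a1 : -1 <= a <= 1.
  by rewrite -ler_norml -(@ler_pXn2r _ 2)// ?nnegrE// expr1n real_normK ?num_real// -ab lerDl sqr_ge0.
have pi0 := @pi_gt0 R.
have [s0 spi] : 0 <= acos a /\ acos a <= pi by rewrite acos_ge0// acos_lepi.
have b2 : b ^+ 2 = 1 - a ^+ 2 by rewrite -ab addrC addKr.
have div_eq (y : R) : 2 * pi * (y / (2 * pi)) = y.
  by rewrite mulrC divfK// mulf_neq0// gt_eqF.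
have [b0|b0] := leP 0 b.
  exists (acos a / (2 * pi)).
    rewrite divr_ge0 ?mulr_ge0 ?(ltW pi0)//= ltr_pdivrMr ?mulr_gt0//; lra.
  by rewrite /expi div_eq acosK// sin_acos// -b2 sqrtr_sqr ger0_norm.
exists ((2 * pi - acos a) / (2 * pi)).
  rewrite divr_ge0 ?mulr_ge0 ?(ltW pi0)//=; last by lra.
  rewrite ltr_pdivrMr ?mulr_gt0// mul1r ltrBlDr ltrDl lt_def s0 andbT.
  apply/eqP => E; have := acosK a1; rewrite E cos0 => aE.
  by move: b2; rewrite -aE expr1n subrr => /eqP; rewrite sqrf_eq0 lt_eqF.
rewrite /expi div_eq (_ : 2 * pi = pi *+ 2); last by rewrite mulr_natl.
rewrite cosB sinB cos2pi sin2pi !mul0r !mul1r addr0 sub0r acosK// sin_acos// -b2.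
by rewrite sqrtr_sqr ltr0_norm// opprK.
Qed.

(** All functions act as scalars, so the real and imaginary parts of U commute with the
    whole algebra under rho and [selfadjoint_eigen] applies to them with f = 1, whose
    range is H. *)
Lemma fixed_point_equivalence (q : disk R) :
  (forall (g : CD) v, rho (iota g) v = g q *: v) ->
  exists (th : R) (sigma : representation B R[i]),
    [/\ 0 <= th < 1, forall v, sigma (gen_A p) v = \val q * v,
        forall v, sigma u v = expi (2 * pi * th) * v &
        unitarily_equivalent rho sigma].
Proof.
move=> scalar.
have comm_iota a g : commute_under rho a (iota g).
  by move=> v; rewrite !repM scalar linearZ /= scalar.
have comm_u (r s : R[i]) d : d = u \/ d = star u ->
    commute_under rho (r *: u + s *: star u) d.
  move=> dE v; rewrite mulrDl mulrDr -!scalerAl -!scalerAr.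
  by case: dE => ->; rewrite (cov_unitary p).1 (cov_unitary p).2.
have eigen v : exists l : R[i], rho u v = l *: v.
  have key a (r s : R[i]) : star a = a -> a = r *: u + s *: star u ->
      exists l : R[i], rho a v = l *: v.
    move=> sa aE.
    have au d : d = u \/ d = star u -> commute_under rho a d.
      by rewrite aE; exact: comm_u.
    have fa : wandering phi (1 : CD) \/
        [/\ (1 : CD) = 1, commute_under rho a u & commute_under rho a (star u)].
      by right; split => //; apply: au; [left|right].
    have [l] := selfadjoint_eigen irr gen v sa (comm_iota a) fa.
    by rewrite rmorph1 (rep1 irr) => lE; exists l.
  have [a1 [a2 [s1 s2 [uE [r1 a1E] [r2 a2E]]]]] := star_Re_Im u.
  have [l1 E1] := key a1 r1 r1 s1 (etrans a1E (scalerDr _ _ _)).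
  have [l2 E2] := key a2 r2 (- r2) s2 (etrans a2E (etrans (scalerBr _ _ _)
    (congr1 _ (esym (scaleNr _ _))))).
  by exists (l1 + 'i * l2); rewrite uE repD repZ E1 E2 scalerA scalerDl.
have [v v1] := unit_vector.
have vn0 : v != 0.
  by apply/eqP => v0; move: v1; rewrite v0 inner0l => /esym/eqP; rewrite oner_eq0.
have [l lE] := eigen v.
have ll : l * l^* = 1.
  by rewrite -[RHS]v1 -(rep_U_inner p irr v v) lE innerZl innerZr v1 mulr1.
have starE : rho (star u) v = l^* *: v.
  have : rho (star u) (rho u v) = v by rewrite -repM (cov_unitary p).1 (rep1 irr).
  by rewrite lE linearZ /= => E; rewrite -[in RHS]E scalerA mulrC ll scale1r.
have stable b r y : rho b v = r *: v -> y = inner y v *: v ->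
    rho b y = inner (rho b y) v *: v.
  by move=> bE ->; rewrite linearZ /= bE !innerZl v1 mulr1 scalerA.
have in_line : forall y, y = inner y v *: v.
  apply: (irreducible_generators irr gen (S := [set y | y = inner y v *: v])
    (w := v)) => //=.
  - split => /=; last 1 first.
    + by move=> c y z yE zE; rewrite innerDl innerZl scalerDl -scalerA -yE -zE.
    + apply: closed_equalizer => [y|y]; first exact: cvg_id.
      by apply: (@cvgZr_tmp _ _ _ (nbhs y)); exact: inner_continuous.
    + by rewrite inner0l scale0r.
  - by move=> g y; apply: (@stable _ (g q)).
  - by move=> y; apply: stable lE.
  - by move=> y; apply: stable starE.
  - by rewrite v1 scale1r.
have W_linear : linear (fun y : H => inner y v : R[i]).
  by move=> c y z; rewrite innerDl innerZl.
pose W : {linear H -> R[i]} := HB.pack (fun y : H => inner y v : R[i])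
  (@GRing.isLinear.Build R[i] H R[i] _ _ W_linear).
have W_inner y z : inner (W y) (W z) = inner y z.
  by rewrite [y in RHS]in_line innerZl (inner_conj z v).
have WK : cancel (fun c : R[i] => c *: v) W.
  by move=> c; rewrite /= innerZl v1 mulr1.
have [sigma sE] := @transport_rep R B H R[i] rho W _ W_inner WK.
have l1 : `|l| = 1 by apply/eqP; rewrite -(@eqrXn2 _ 2)// normCK ll expr1n.
have [th th1 thE] := expi_surjective l1.
exists th, sigma; split => //.
- by move=> c; rewrite -{1}(WK c) -sE scalar [LHS]linearZ WK.
- move=> c; rewrite -{1}(WK c) -sE; have -> : rho u (c *: v) = (c * l) *: v.
    by rewrite linearZ /= lE scalerA.
  by rewrite WK thE mulrC.
- by exists W; split => // c; exists (c *: v); exact: WK.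
Qed.

End FixedPointRepresentation.

Theorem theorem3p10 (R : realType) (phi : homeo (disk R))
    (B : cstarAlgType R) (p : covariant_pair phi B)
    (H : hilbertType R) (rho : representation B H) :
  hyperbolic phi ->
  (forall z : disk R, \val z = 1 -> phi z = z) ->
  (forall z : disk R, \val z = -1 -> phi z = z) ->
  is_crossed_product p ->
  irreducible rho ->
  (exists (x : disk R) (sigma : representation B (l2Z R)),
     [/\ \val x <> 1, \val x <> -1, is_pi_x p x sigma &
         unitarily_equivalent rho sigma]) \/
  (exists (eps theta : R) (sigma : representation B R[i]),
     [/\ eps = -1 \/ eps = 1, 0 <= theta < 1, is_pi_theta_eps p theta eps sigma &
         unitarily_equivalent rho sigma]).
Proof.
move=> hyp fix1 fixN1 [gen _] irr.
have [t [t0 t1 form]] := hyperbolic_real_form hyp fix1 fixN1.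
case: (pselect (forall f, wandering phi f -> forall v, rho (cov_iota p f) v = 0)) => [nw|].
  right; have [q [qE scalar]] := no_wandering_fixed irr gen t0 t1 form nw.
  have [th [sigma [th1 sA sU eqv]]] := fixed_point_equivalence irr gen scalar.
  case: qE => qE; [exists 1, th, sigma|exists (-1), th, sigma]; split => //;
    [by right| |by left|]; split => // v; rewrite sA qE ?rmorphN ?rmorph1//.
move=> nw; left.
have [f [fw [v0 w0]]] : exists f, wandering phi f /\ exists v, rho (cov_iota p f) v != 0.
  apply/not_existsP => no; apply: nw => f fw v; apply/eqP/negPn/negP => fv.
  by apply: (no f); split => //; exists v.
set w := rho (cov_iota p f) v0 in w0.
have [x xE] : exists x : disk R, forall g : CD R, rho (cov_iota p g) w = g x *: w.
  apply: (eigencharacter_eval irr w0) => g.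
  apply: iota_eigen_all => a sa [h hE].
  apply: (selfadjoint_eigen irr gen v0 sa); last by left.
  by move=> k y; rewrite hE -!rmorphM CD_mulC.
have fx : f x != 0.
  apply/eqP => fx0.
  have : rho (cov_iota p (star f)) w = 0.
    by rewrite xE (_ : star f x = 0) ?scale0r// -[LHS]/((f x)^*) fx0 rmorph0.
  rewrite /w -repM -rmorphM => E; move: w0; rewrite -normr_eq0 -sqrf_eq0.
  by rewrite norm_rep_iota E inner0l eqxx.
have xfix : phi x <> x.
  move=> phix; have := congr1 (fun g : CD R => g x) (fw 1%N isT).
  rewrite -[LHS]/(f x * f (phi x)) phix => /eqP.
  by rewrite mulf_eq0 (negPf fx).
have [w' w'1 w'E] : exists2 w', inner w' w' = 1 &
    forall g : CD R, rho (cov_iota p g) w' = g x *: w'.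
  exists (`|w|^-1 *: w).
    by rewrite -sqr_norm_inner normrZ normfV normr_id mulVf ?expr1n// normr_eq0.
  by move=> g; rewrite linearZ /= xE !scalerA mulrC.
have [sigma [pix eqv]] := orbit_equivalence irr gen fw fx w'1 w'E.
exists x, sigma; split => // xE1; apply: xfix; [exact: fix1|exact: fixN1].
Qed.
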